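(* Fix $r\ge1$ and let $\varepsilon_r=\left(2^{r-m}\,2r\ln m\right)^{1/2^{r+1}}$. For $\mathrm{RM}(r,m)$ used on a binary symmetric channel with crossover probability $(1-\varepsilon_r)/2$, the algorithm $\Psi_r^m$ has, as $m\to\infty$, $$\max_{\xi\in\Gamma}p(\xi)\le(1+o(1))\,\frac{m^{-r}}{\sqrt{4\pi r\ln m}},$$ with asymptotic equality $p(\xi_* )=(1+o(1))\,m^{-r}/\sqrt{4\pi r\ln m}$ on the path $\xi_*=(0^r,1^{m-r})$.
   Context: Assume the all-ones codeword (in $\pm1$ form) is sent; received $y_1,\dots,y_n$ ($n=2^m$) are i.i.d. with $\Pr\{y_i=-1\}=(1-\varepsilon_r)/2$, $\Pr\{y_i=1\}=(1+\varepsilon_r)/2$. For binary strings $\xi$ define $\mathbf y(\varnothing)=\mathbf y$ and, splitting $\mathbf y(\underline\xi)=(\mathbf y'(\underline\xi),\mathbf y''(\underline\xi))$ into halves, $\mathbf y(\underline\xi,0)=\mathbf y'(\underline\xi)\mathbf y''(\underline\xi)$ (componentwise), $\mathbf y(\underline\xi,1)=(\mathbf y'(\underline\xi)+\mathbf y''(\underline\xi))/2$; these are the inputs of the recursive decoder $\Psi_r^m$ (which on $(\mathbf y',\mathbf y'')$ decodes $\mathbf y'\mathbf y''$ in $\mathrm{RM}(r-1,m-1)$ to get $\hat{\mathbf v}$, then $(\mathbf y'+\mathbf y''\hat{\mathbf v})/2$ in $\mathrm{RM}(r,m-1)$, with MD decoding at $r=0$ or $r=m$) when all previous decisions are correct.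 Paths: from node $(m,r)$ a step $0$ goes to $(m'-1,r'-1)$, a step $1$ to $(m'-1,r')$, stopping at $(g,0)$ or $(h,h)$ ($g,h\ge1$); $\Gamma$ is the set of information paths: left-end paths (end subpath to $(g,0)$ followed by $1^g$) and right-end paths (end subpath $\underline\xi$ to $(h,h)$ followed by any $h$-bit string $\sigma$); equivalently, binary strings of length $m$ and weight $\ge m-r$. The decision statistic $y(\xi)$ is the single entry of $\mathbf y(\xi)$ for a left-end path (the average of the entries of the vector at the repetition node), and the entry of $\mathbf y(\underline\xi)$ indexed by $\sigma$ for a right-end path. $p(\xi)=\Pr\{y(\xi)<0\}+\tfrac12\Pr\{y(\xi)=0\}$ is the bit error probability at $\xi$ given that all previous decodings were correct. *)

(* Defs.v *)
From Stdlib Require Import Reals List.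
Import ListNotations.
Open Scope R_scope.

Fixpoint all_words (n : nat) : list (list bool) :=
  match n with
  | O => [ [] ]
  | S k => map (cons false) (all_words k) ++ map (cons true) (all_words k)
  end.

Definition pm (w : list bool) : list R := map (fun b : bool => if b then 1%R else (-1)%R) w.

Definition word_prob (e : R) (w : list bool) : R :=
  fold_right (fun (b : bool) (acc : R) => (if b then (1 + e) / 2 else (1 - e) / 2) * acc) 1 w.

Definition half1 (v : list R) : list R := firstn (Nat.div (length v) 2) v.
Definition half2 (v : list R) : list R := skipn (Nat.div (length v) 2) v.

Definition step0 (v : list R) : list R :=
  map (fun p => fst p * snd p) (combine (half1 v) (half2 v)).
Definition step1 (v : list R) : list R :=
  map (fun p => (fst p + snd p) / 2) (combine (half1 v) (half2 v)).

Definition avg (v : list R) : R := fold_right Rplus 0 v / INR (length v).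

Fixpoint idx (v : list R) (s : list bool) : R :=
  match s with
  | [] => hd 0 v
  | b :: t => idx (if b then half2 v else half1 v) t
  end.

(* Decision statistic y(xi) along the path xi, starting at node (mm, rr)
   with current vector v.  Step false (= 0) goes to (mm-1, rr-1), step true
   (= 1) to (mm-1, rr).  At a node (g,0) the statistic is the average of the
   entries (repetition code node); at a node (h,h) it is the entry indexed by
   the remaining h-bit string sigma. *)
Fixpoint stat (mm rr : nat) (xi : list bool) (v : list R) : R :=
  if Nat.eqb rr 0 then avg v
  else if Nat.eqb rr mm then idx v xi
  else match xi with
       | [] => hd 0 v
       | false :: t => stat (mm - 1) (rr - 1) t (step0 v)
       | true :: t => stat (mm - 1) rr t (step1 v)
       end.

Definition err_ind (s : R) : R :=
  if Rlt_dec s 0 then 1 else if Req_EM_T s 0 then / 2 else 0.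

Definition perr (e : R) (m r : nat) (xi : list bool) : R :=
  fold_right Rplus 0
    (map (fun w => word_prob e w * err_ind (stat m r xi (pm w)))
         (all_words (2 ^ m))).

Definition Gamma (m r : nat) : list (list bool) :=
  filter (fun xi => Nat.leb (m - r) (count_occ Bool.bool_dec xi true)) (all_words m).

Definition eps_r (r m : nat) : R :=
  Rpower (Rpower 2 (INR r - INR m) * (2 * INR r * ln (INR m))) (/ 2 ^ (r + 1)).

Definition rm_bound (r m : nat) : R :=
  / (INR m ^ r) / sqrt (4 * PI * INR r * ln (INR m)).

Definition xi_star (m r : nat) : list bool := repeat false r ++ repeat true (m - r).

(* Main.v *)
Require Import Defs.
From Stdlib Require Import Reals List Lra Lia Psatz.
From Coquelicot Require Import Coquelicot.
Import ListNotations.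
Open Scope R_scope.

(** Write [L = 2 r ln m], [d = eps_r^(2^r)] and [W = 1/d], so that
    [2^(m-r) = L W^2] and the bound is [exp (-L/2) / sqrt (2 PI L)].

    Along a path the entries of the current vector stay independent and identically
    distributed, with a relative variance [v] (variance over squared mean) that a
    step 0 turns into [(1+v)^2 - 1] and a step 1 into [v/2].  For a right-end path
    the final [v] is at most [1/(L W)], and Chebyshev's inequality suffices.  A
    left-end path other than [xi_star] has [c >= 1] steps 1 before its last step 0,
    and its statistic averages [2^(m-r-c)] independent variables whose [1+v] is at
    most [(1 + W/2^c)^2].  If [4^c] is small against [W], this nearly doubles
    the exponent [L/2], and a Chernoff bound gives [exp (-3L/5)]; otherwise Chebyshev's
    inequality gives [O(1/(L sqrt W))].  Both are below the bound.

    On [xi_star] the statistic is an average of [2M = 2^(m-r)] independent signs of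
    mean [d], and the error probability is
    [C(2M,M) 4^(-M) (1-d^2)^M (1/2 + sum_(i=1..M) R_i rho^i)] with
    [rho = (1-d)/(1+d)] and [1 - i^2/M <= R_i <= 1].  As [rho^i] is concentrated on
    [i = O(1/d)], where [i^2/M = O(1/L)], the last factor is [(1 + O(1/L)) / (2d)],
    and Wallis' formula for [C(2M,M)] concludes. *)

(** * Finite laws *)

(** A finite weighted list in which a value may occur several times. Laws are compared only through
    [expect], so repeated atoms are harmless. *)
Definition law (A : Type) := list (A * R).

Definition expect {A} (l : law A) (f : A -> R) : R :=
  fold_right (fun p acc => snd p * f (fst p) + acc) 0 l.

Definition ret {A} (a : A) : law A := [(a, 1)].

Definition bind {A B} (l : law A) (k : A -> law B) : law B :=
  flat_map (fun p => map (fun q => (fst q, snd p * snd q)) (k (fst p))) l.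

(** One step of the recursion turns independent entries of law [l] into independent entries of this
    law, with [op] the product or the half-sum. *)
Definition lift2 (op : R -> R -> R) (l : law R) : law R :=
  bind l (fun x => bind l (fun y => ret (op x y))).

Fixpoint iid (l : law R) (n : nat) : law (list R) :=
  match n with
  | O => ret []
  | S k => bind l (fun x => bind (iid l k) (fun v => ret (x :: v)))
  end.

Definition supported {A} (l : law A) (P : A -> Prop) : Prop :=
  forall a p, In (a, p) l -> P a.

Definition is_law {A} (l : law A) : Prop :=
  (forall a p, In (a, p) l -> 0 <= p) /\ expect l (fun _ => 1) = 1.

Lemma expect_ext_on {A} (l : law A) (P : A -> Prop) (f g : A -> R) :
  supported l P -> (forall a, P a -> f a = g a) -> expect l f = expect l g.
Proof.
  intros hl h. induction l as [|[a p] l IH]; simpl; [reflexivity|].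
  rewrite (h a), IH; [reflexivity| |].
  - intros b q hb. apply (hl b q). now right.
  - apply (hl a p). now left.
Qed.

Lemma expect_ext {A} (l : law A) (f g : A -> R) :
  (forall a, f a = g a) -> expect l f = expect l g.
Proof.
  intros h. apply (expect_ext_on l (fun _ => True)); [intros ? ? ?; exact I|auto].
Qed.

Lemma expect_le {A} (l : law A) (P : A -> Prop) (f g : A -> R) :
  is_law l -> supported l P -> (forall a, P a -> f a <= g a) ->
  expect l f <= expect l g.
Proof.
  intros [hw _] hl h. induction l as [|[a p] l IH]; simpl; [lra|].
  apply Rplus_le_compat.
  - apply Rmult_le_compat_l; [apply (hw a); now left|].
    apply h, (hl a p). now left.
  - apply IH.
    + intros b q hb. apply (hw b). now right.
    + intros b q hb. apply (hl b q). now right.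
Qed.

Lemma expect_plus {A} (l : law A) (f g : A -> R) :
  expect l (fun a => f a + g a) = expect l f + expect l g.
Proof. induction l as [|[a p] l IH]; simpl; [ring|rewrite IH; ring]. Qed.

Lemma expect_scal {A} (l : law A) (c : R) (f : A -> R) :
  expect l (fun a => c * f a) = c * expect l f.
Proof. induction l as [|[a p] l IH]; simpl; [ring|rewrite IH; ring]. Qed.

Lemma expect_const {A} (l : law A) (c : R) :
  is_law l -> expect l (fun _ => c) = c.
Proof.
  intros [_ h]. rewrite (expect_ext l _ (fun _ => c * 1)) by (intros; ring).
  rewrite expect_scal, h. ring.
Qed.

Lemma expect_app {A} (l k : law A) (f : A -> R) :
  expect (l ++ k) f = expect l f + expect k f.
Proof. induction l as [|[a p] l IH]; simpl; [ring|rewrite IH; ring]. Qed.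

Lemma expect_ret {A} (a : A) (f : A -> R) : expect (ret a) f = f a.
Proof. unfold expect, ret. simpl. ring. Qed.

Lemma expect_bind {A B} (l : law A) (k : A -> law B) (f : B -> R) :
  expect (bind l k) f = expect l (fun a => expect (k a) f).
Proof.
  induction l as [|[a p] l IH]; simpl; [reflexivity|].
  rewrite expect_app, IH. f_equal.
  induction (k a) as [|[b q] t IHt]; simpl; [ring|rewrite IHt; ring].
Qed.

Lemma expect_swap {A B} (l : law A) (k : law B) (f : A -> B -> R) :
  expect l (fun a => expect k (f a)) = expect k (fun b => expect l (fun a => f a b)).
Proof.
  induction l as [|[a p] l IH]; simpl.
  - symmetry. rewrite (expect_ext k _ (fun _ => 0 * 0)) by (intros; ring).
    rewrite expect_scal. ring.
  - rewrite IH, expect_plus, expect_scal. reflexivity.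
Qed.

Lemma in_bind {A B} (l : law A) (k : A -> law B) b q :
  In (b, q) (bind l k) ->
  exists a p q', In (a, p) l /\ In (b, q') (k a) /\ q = p * q'.
Proof.
  unfold bind. rewrite in_flat_map. intros [[a p] [h1 h2]].
  apply in_map_iff in h2. destruct h2 as [[b' q'] [h2 h3]].
  inversion h2; subst. exists a, p, q'. auto.
Qed.

Lemma supported_ret {A} (a : A) (P : A -> Prop) : P a -> supported (ret a) P.
Proof. intros h b q [hb|[]]. inversion hb; subst. exact h. Qed.

Lemma supported_bind {A B} (l : law A) (k : A -> law B) (P : A -> Prop) (Q : B -> Prop) :
  supported l P -> (forall a, P a -> supported (k a) Q) -> supported (bind l k) Q.
Proof.
  intros hl hk b q hb. apply in_bind in hb.
  destruct hb as (a & p & q' & ha & hb & _).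
  exact (hk a (hl a p ha) b q' hb).
Qed.

Lemma is_law_ret {A} (a : A) : is_law (ret a).
Proof.
  split; [|exact (expect_ret a (fun _ => 1))].
  intros b q [hb|[]]. inversion hb; lra.
Qed.

Lemma is_law_bind {A B} (l : law A) (k : A -> law B) :
  is_law l -> (forall a, is_law (k a)) -> is_law (bind l k).
Proof.
  intros hl hk. split.
  - intros b q hb. apply in_bind in hb.
    destruct hb as (a & p & q' & ha & hb & ->).
    apply Rmult_le_pos; [exact (proj1 hl a p ha)|exact (proj1 (hk a) b q' hb)].
  - rewrite expect_bind.
    rewrite (expect_ext l _ (fun _ => 1)) by (intros a; exact (proj2 (hk a))).
    exact (proj2 hl).
Qed.

Lemma is_law_lift2 op l : is_law l -> is_law (lift2 op l).
Proof. intros hl. repeat (apply is_law_bind; [exact hl|intros]). apply is_law_ret. Qed.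

Lemma expect_lift2 op l f :
  expect (lift2 op l) f = expect l (fun x => expect l (fun y => f (op x y))).
Proof.
  unfold lift2. rewrite expect_bind. apply expect_ext; intros x.
  rewrite expect_bind. apply expect_ext; intros y. apply expect_ret.
Qed.

(** * Vectors of independent identically distributed entries *)

Lemma is_law_iid l n : is_law l -> is_law (iid l n).
Proof.
  intros hl. induction n as [|n IH]; simpl; [apply is_law_ret|].
  apply is_law_bind; [exact hl|intros x].
  apply is_law_bind; [exact IH|intros v]. apply is_law_ret.
Qed.

Lemma expect_iid_S l n f :
  expect (iid l (S n)) f = expect l (fun x => expect (iid l n) (fun v => f (x :: v))).
Proof.
  simpl. rewrite expect_bind. apply expect_ext; intros x.
  rewrite expect_bind. apply expect_ext; intros v. apply expect_ret.
Qed.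

Lemma expect_iid_0 l f : expect (iid l 0) f = f [].
Proof. apply expect_ret. Qed.

Lemma iid_length l n : supported (iid l n) (fun v => length v = n).
Proof.
  induction n as [|n IH]; simpl; [now apply supported_ret|].
  apply supported_bind with (P := fun _ => True); [intros ? ? ?; exact I|intros x _].
  apply supported_bind with (1 := IH); intros v hv.
  apply supported_ret. simpl. now rewrite hv.
Qed.

Lemma expect_iid_add l n k f :
  expect (iid l (n + k)) f =
  expect (iid l n) (fun u => expect (iid l k) (fun w => f (u ++ w))).
Proof.
  revert f. induction n as [|n IH]; intros f; simpl Nat.add.
  - now rewrite expect_iid_0.
  - rewrite !expect_iid_S. apply expect_ext; intros x. apply IH.
Qed.

Lemma half1_app u w : length u = length w -> half1 (u ++ w) = u.
Proof.
  intros h. unfold half1. rewrite length_app, <- h.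
  replace (length u + length u)%nat with (length u * 2)%nat by lia.
  rewrite Nat.div_mul by lia. rewrite firstn_app, Nat.sub_diag, firstn_all.
  simpl. apply app_nil_r.
Qed.

Lemma half2_app u w : length u = length w -> half2 (u ++ w) = w.
Proof.
  intros h. unfold half2. rewrite length_app, <- h.
  replace (length u + length u)%nat with (length u * 2)%nat by lia.
  rewrite Nat.div_mul by lia. rewrite skipn_app, Nat.sub_diag, skipn_all.
  reflexivity.
Qed.

Lemma expect_iid_halves l n (F : list R -> list R -> R) :
  expect (iid l (n + n)) (fun v => F (half1 v) (half2 v)) =
  expect (iid l n) (fun u => expect (iid l n) (fun w => F u w)).
Proof.
  rewrite expect_iid_add.
  apply expect_ext_on with (1 := iid_length l n); intros u hu.
  apply expect_ext_on with (1 := iid_length l n); intros w hw.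
  rewrite half1_app, half2_app by lia. reflexivity.
Qed.

(** Each entry of [u] meets exactly one entry of [w], so the results are again independent. In the
    induction, [expect_swap] brings the two heads together. *)
Lemma expect_iid_zip op l n F :
  expect (iid l n) (fun u => expect (iid l n)
    (fun w => F (map (fun p => op (fst p) (snd p)) (combine u w)))) =
  expect (iid (lift2 op l) n) F.
Proof.
  revert F. induction n as [|n IH]; intros F.
  - now rewrite !expect_iid_0.
  - rewrite !expect_iid_S, expect_lift2. apply expect_ext; intros x.
    rewrite (expect_ext _ _ (fun u => expect l (fun y => expect (iid l n)
      (fun w => F (op x y :: map (fun p => op (fst p) (snd p)) (combine u w)))))).
    2:{ intros u. now rewrite expect_iid_S. }
    rewrite expect_swap. apply expect_ext; intros y.
    exact (IH (fun v => F (op x y :: v))).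
Qed.

(** * Error probability of a path under independent signs *)

Definition signs (e : R) : law R := [(-1, (1 - e) / 2); (1, (1 + e) / 2)].

Lemma expect_signs e f :
  expect (signs e) f = (1 - e) / 2 * f (-1) + (1 + e) / 2 * f 1.
Proof. unfold expect, signs; simpl; ring. Qed.

Lemma is_law_signs e : -1 <= e <= 1 -> is_law (signs e).
Proof.
  intros he. split; [|rewrite expect_signs; field].
  intros a p [h|[h|[]]]; inversion h; subst; lra.
Qed.

(** Bridge from the sum over all received words, which defines [perr], to independent signs of mean
    [e]. *)
Lemma expect_words e n f :
  fold_right Rplus 0 (map (fun w => word_prob e w * f (pm w)) (all_words n)) =
  expect (iid (signs e) n) f.
Proof.
  revert f. induction n as [|n IH]; intros f.
  - rewrite expect_iid_0. unfold pm; simpl. ring.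
  - assert (hsum : forall (g : list bool -> R) (h : list bool -> R) c s,
      (forall w, g w = c * h w) ->
      fold_right Rplus 0 (map g s) = c * fold_right Rplus 0 (map h s)).
    { intros g h c s hg. induction s as [|w s IHs]; simpl; [ring|].
      rewrite IHs, hg. ring. }
    assert (happ : forall s t, fold_right Rplus 0 (s ++ t) =
      fold_right Rplus 0 s + fold_right Rplus 0 t).
    { intros s t. induction s as [|x s IHs]; simpl; [ring|rewrite IHs; ring]. }
    rewrite expect_iid_S, expect_signs, <- !IH.
    simpl all_words. rewrite map_app, happ, !map_map.
    f_equal; apply hsum; intros w; simpl; ring.
Qed.

Definition path_err (l : law R) (m r : nat) (xi : list bool) : R :=
  expect (iid l (2 ^ m)) (fun v => err_ind (stat m r xi v)).

Lemma perr_path_err e m r xi : perr e m r xi = path_err (signs e) m r xi.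
Proof. exact (expect_words e (2 ^ m) (fun v => err_ind (stat m r xi v))). Qed.

Lemma expect_iid_step op l m F :
  expect (iid l (2 ^ S m)) (fun v => F (map (fun p => op (fst p) (snd p))
    (combine (half1 v) (half2 v)))) = expect (iid (lift2 op l) (2 ^ m)) F.
Proof.
  replace (2 ^ S m)%nat with (2 ^ m + 2 ^ m)%nat by (simpl; lia).
  rewrite (expect_iid_halves l _ (fun u w => F (map (fun p => op (fst p) (snd p))
    (combine u w)))).
  apply expect_iid_zip.
Qed.

Definition mean2 (x y : R) : R := (x + y) / 2.

Lemma path_err_false l m r t :
  (r <> m)%nat ->
  path_err l (S m) (S r) (false :: t) = path_err (lift2 Rmult l) m r t.
Proof.
  intros hr. unfold path_err. rewrite <- expect_iid_step.
  apply expect_ext; intros v. simpl.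
  destruct (Nat.eqb_spec r m); [contradiction|]. now rewrite !Nat.sub_0_r.
Qed.

Lemma path_err_true l m r t :
  (0 < r)%nat -> (r <> S m)%nat ->
  path_err l (S m) r (true :: t) = path_err (lift2 mean2 l) m r t.
Proof.
  intros h0 hr. unfold path_err. rewrite <- expect_iid_step.
  apply expect_ext; intros v. cbn [stat].
  destruct (Nat.eqb_spec r 0); [lia|].
  destruct (Nat.eqb_spec r (S m)); [contradiction|].
  replace (S m - 1)%nat with m by lia. reflexivity.
Qed.

(** Each bit of [s] selects one half; the other half integrates to 1, and a single entry remains. *)
Lemma expect_idx l f s :
  is_law l -> expect (iid l (2 ^ length s)) (fun v => f (idx v s)) = expect l f.
Proof.
  intros hl. induction s as [|b s IH].
  - simpl length. change (2 ^ 0)%nat with 1%nat. rewrite expect_iid_S.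
    apply expect_ext; intros x. now rewrite expect_iid_0.
  - simpl length.
    replace (2 ^ S (length s))%nat with (2 ^ length s + 2 ^ length s)%nat
      by (simpl; lia).
    simpl idx.
    rewrite (expect_iid_halves l _ (fun u w => f (idx (if b then w else u) s))).
    destruct b.
    + rewrite expect_const by now apply is_law_iid. exact IH.
    + rewrite <- IH. apply expect_ext; intros u.
      apply expect_const. now apply is_law_iid.
Qed.

Lemma path_err_diag l h s :
  is_law l -> (0 < h)%nat -> length s = h -> path_err l h h s = expect l err_ind.
Proof.
  intros hl hh <-. rewrite <- (expect_idx l err_ind s hl). unfold path_err.
  apply expect_ext; intros v. destruct s as [|b s]; [simpl in hh; lia|].
  cbn [stat length]. rewrite Nat.eqb_refl. reflexivity.
Qed.

(** * Sums of independent entries and bounds on the error indicator *)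

Definition sum (v : list R) : R := fold_right Rplus 0 v.

Definition sum_err (l : law R) (n : nat) : R :=
  expect (iid l n) (fun v => err_ind (sum v)).

(** Only the sign of the argument matters, so the average at a repetition node may be replaced by
    the sum. *)
Lemma err_ind_div x c : 0 < c -> err_ind (x / c) = err_ind x.
Proof.
  intros hc. unfold err_ind.
  assert (hx : x = x / c * c) by (field; lra).
  set (q := x / c) in *. clearbody q. subst x.
  destruct (Rlt_dec q 0), (Rlt_dec (q * c) 0); try reflexivity; [nra|nra|].
  destruct (Req_EM_T q 0), (Req_EM_T (q * c) 0); try reflexivity.
  - subst. rewrite Rmult_0_l in *. lra.
  - apply Rmult_integral in e. lra.
Qed.

Lemma path_err_rep l m xi : path_err l m 0 xi = sum_err l (2 ^ m).
Proof.
  unfold path_err, sum_err.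
  apply expect_ext_on with (1 := iid_length l _); intros v hv.
  assert (h : stat m 0 xi v = avg v) by (destruct xi; reflexivity).
  rewrite h. apply err_ind_div. rewrite hv. apply lt_0_INR.
  apply Nat.neq_0_lt_0, Nat.pow_nonzero. lia.
Qed.

Lemma err_ind_chebyshev x a : 0 < a -> err_ind x <= (x - a) ^ 2 / a ^ 2.
Proof.
  intros ha. apply Rmult_le_reg_r with (a ^ 2); [nra|].
  replace ((x - a) ^ 2 / a ^ 2 * a ^ 2) with ((x - a) ^ 2) by (field; lra).
  unfold err_ind. pose proof (pow2_ge_0 (x - a)).
  destruct (Rlt_dec x 0); [nra|].
  destruct (Req_EM_T x 0); [subst; nra|lra].
Qed.

Lemma err_ind_chernoff x t : 0 <= t -> err_ind x <= exp (- t * x).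
Proof.
  intros ht. unfold err_ind. pose proof (exp_ineq1_le (- t * x)).
  destruct (Rlt_dec x 0); [nra|]. destruct (Req_EM_T x 0).
  - subst. lra.
  - apply Rlt_le, exp_pos.
Qed.

Lemma expect_sum l n : is_law l -> expect (iid l n) sum = INR n * expect l (fun x => x).
Proof.
  intros hl. induction n as [|n IH].
  - rewrite expect_iid_0. unfold sum; simpl. ring.
  - rewrite expect_iid_S, S_INR.
    rewrite (expect_ext _ _ (fun x => x + INR n * expect l (fun x => x))).
    + rewrite expect_plus, expect_const by exact hl. ring.
    + intros x. unfold sum at 1; simpl. change (fold_right Rplus 0) with sum.
      now rewrite expect_plus, expect_const, IH by now apply is_law_iid.
Qed.

Lemma expect_sum_sqr l n :
  is_law l ->
  expect (iid l n) (fun v => sum v ^ 2) =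
  INR n * expect l (fun x => x ^ 2) + INR n * (INR n - 1) * expect l (fun x => x) ^ 2.
Proof.
  intros hl. induction n as [|n IH].
  - rewrite expect_iid_0. unfold sum; simpl. ring.
  - rewrite expect_iid_S, S_INR.
    set (a := expect l (fun x => x)) in *. set (s := expect l (fun x => x ^ 2)) in *.
    rewrite (expect_ext _ _ (fun x => x ^ 2 + (2 * (INR n * a) * x
      + (INR n * s + INR n * (INR n - 1) * a ^ 2)))).
    + rewrite !expect_plus, !expect_scal, !expect_const by exact hl.
      fold a s. ring.
    + intros x.
      rewrite (expect_ext _ _ (fun v => x ^ 2 + (2 * x * sum v + sum v ^ 2))).
      * rewrite !expect_plus, !expect_scal, !expect_const, IH, expect_sum
          by (try apply is_law_iid; exact hl).
        fold a. ring.
      * intros v. unfold sum; simpl. ring.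
Qed.

Lemma expect_exp_sum l n t :
  expect (iid l n) (fun v => exp (t * sum v)) = expect l (fun x => exp (t * x)) ^ n.
Proof.
  induction n as [|n IH].
  - rewrite expect_iid_0. unfold sum; simpl. rewrite Rmult_0_r. apply exp_0.
  - rewrite expect_iid_S, <- tech_pow_Rmult.
    rewrite (expect_ext _ _ (fun x => expect l (fun x => exp (t * x)) ^ n * exp (t * x))).
    + rewrite expect_scal. ring.
    + intros x. rewrite <- IH, (Rmult_comm (expect _ _)), <- expect_scal.
      apply expect_ext; intros v. rewrite <- exp_plus. f_equal. unfold sum; simpl. ring.
Qed.

(** * Relative variance and tail bounds *)

(** Here [v] is only an upper bound on the relative variance, so it may be enlarged. The support in
    [-1, 1] keeps the exponents small in the Chernoff bound. *)
Record good (l : law R) (a v : R) : Prop := {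
  good_law : is_law l;
  good_supp : supported l (fun x => -1 <= x <= 1);
  good_mean : expect l (fun x => x) = a;
  good_pos : 0 < a;
  good_var_pos : 0 <= v;
  good_sqr : expect l (fun x => x ^ 2) <= a ^ 2 * (1 + v) }.

Lemma good_signs e : 0 < e <= 1 -> good (signs e) e (/ e ^ 2 - 1).
Proof.
  intros he. split.
  - apply is_law_signs. lra.
  - intros a p [h|[h|[]]]; inversion h; subst; lra.
  - rewrite expect_signs. field.
  - lra.
  - rewrite <- pow_inv.
    assert (1 <= / e) by (rewrite <- Rinv_1; apply Rinv_le_contravar; lra). nra.
  - rewrite expect_signs. right. field. lra.
Qed.

Lemma good_le l a v v' : good l a v -> v <= v' -> good l a v'.
Proof.
  intros [h1 h2 h3 h4 h5 h6] h. split; auto; [lra|].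
  apply Rle_trans with (1 := h6). apply Rmult_le_compat_l; [nra|lra].
Qed.

Lemma supported_lift2 op l :
  (forall x y, -1 <= x <= 1 -> -1 <= y <= 1 -> -1 <= op x y <= 1) ->
  supported l (fun x => -1 <= x <= 1) -> supported (lift2 op l) (fun x => -1 <= x <= 1).
Proof.
  intros hop hl. apply supported_bind with (1 := hl); intros x hx.
  apply supported_bind with (1 := hl); intros y hy. apply supported_ret. auto.
Qed.

(** Second moments of independent factors multiply, so [1 + v] is squared along with the mean. *)
Lemma good_mult l a v :
  good l a v -> good (lift2 Rmult l) (a ^ 2) ((1 + v) ^ 2 - 1).
Proof.
  intros [h1 h2 h3 h4 h5 h6].
  split.
  - now apply is_law_lift2.
  - apply supported_lift2; [|exact h2]. intros x y hx hy. split; nra.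
  - rewrite expect_lift2.
    rewrite (expect_ext l _ (fun x => a * x)).
    + rewrite expect_scal, h3. ring.
    + intros x. rewrite expect_scal, h3. ring.
  - apply pow_lt; exact h4.
  - nra.
  - rewrite expect_lift2. set (s := expect l (fun x => x ^ 2)) in *.
    rewrite (expect_ext l _ (fun x => s * x ^ 2)).
    + rewrite expect_scal. fold s.
      replace ((a ^ 2) ^ 2 * (1 + ((1 + v) ^ 2 - 1))) with ((a ^ 2 * (1 + v)) ^ 2) by ring.
      assert (0 <= s).
      { unfold s. replace 0 with (expect l (fun _ => 0)) by now apply expect_const.
        apply expect_le with (1 := h1) (2 := h2). intros; nra. }
      replace (s * s) with (s ^ 2) by ring. apply pow_incr. lra.
    + intros x. unfold s.
      rewrite (expect_ext l _ (fun y => x ^ 2 * y ^ 2)) by (intros; ring).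
      rewrite expect_scal. ring.
Qed.

(** The mean of two independent copies has half the variance. *)
Lemma good_mean2 l a v : good l a v -> good (lift2 mean2 l) a (v / 2).
Proof.
  intros [h1 h2 h3 h4 h5 h6]. split; auto.
  - now apply is_law_lift2.
  - apply supported_lift2; [|exact h2]. intros x y hx hy. unfold mean2; lra.
  - rewrite expect_lift2. unfold mean2.
    rewrite (expect_ext l _ (fun x => / 2 * x + / 2 * a)).
    + rewrite expect_plus, !expect_scal, !expect_const, h3 by exact h1. field.
    + intros x. rewrite (expect_ext l _ (fun y => / 2 * x + / 2 * y)) by (intros; field).
      rewrite expect_plus, !expect_scal, !expect_const, h3 by exact h1. field.
  - lra.
  - rewrite expect_lift2. unfold mean2.
    set (s := expect l (fun x => x ^ 2)) in *.
    rewrite (expect_ext l _ (fun x => / 4 * x ^ 2 + (/ 2 * a * x + / 4 * s))).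
    + rewrite !expect_plus, !expect_scal, !expect_const, h3 by exact h1. fold s. nra.
    + intros x.
      rewrite (expect_ext l _ (fun y => / 4 * x ^ 2 + (/ 2 * x * y + / 4 * y ^ 2)))
        by (intros; field).
      rewrite !expect_plus, !expect_scal, !expect_const, h3 by exact h1. fold s. ring.
Qed.

Lemma err_chebyshev l a v : good l a v -> expect l err_ind <= v.
Proof.
  intros [h1 h2 h3 h4 h5 h6].
  apply Rle_trans with (expect l (fun x => (x - a) ^ 2 / a ^ 2)).
  - apply expect_le with (1 := h1) (2 := h2). intros x _. now apply err_ind_chebyshev.
  - rewrite (expect_ext l _ (fun x => / a ^ 2 * (x ^ 2 + (-2 * a * x + a ^ 2))))
      by (intros; field; lra).
    rewrite expect_scal, !expect_plus, !expect_scal, !expect_const, h3 by exact h1.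
    apply Rmult_le_reg_l with (a ^ 2); [nra|].
    rewrite <- Rmult_assoc, Rinv_r by nra. nra.
Qed.

Lemma sum_err_chebyshev l a v n :
  good l a v -> (0 < n)%nat -> sum_err l n <= v / INR n.
Proof.
  intros [h1 h2 h3 h4 h5 h6] hn. apply lt_0_INR in hn.
  assert (hna : 0 < INR n * a) by now apply Rmult_lt_0_compat.
  pose proof (is_law_iid l n h1) as hi.
  apply Rle_trans with
    (expect (iid l n) (fun x => (sum x - INR n * a) ^ 2 / (INR n * a) ^ 2)).
  - apply expect_le with (P := fun _ => True); [exact hi|intros ? ? ?; exact I|].
    intros x _. now apply err_ind_chebyshev.
  - rewrite (expect_ext _ _ (fun x => / (INR n * a) ^ 2 *
      (sum x ^ 2 + (-2 * (INR n * a) * sum x + (INR n * a) ^ 2))))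
      by (intros; field; lra).
    rewrite expect_scal, !expect_plus, !expect_scal, !expect_const by exact hi.
    rewrite expect_sum_sqr, expect_sum, h3 by exact h1.
    apply Rmult_le_reg_l with ((INR n * a) ^ 2); [now apply pow_lt|].
    rewrite <- Rmult_assoc, Rinv_r by (apply pow_nonzero; lra).
    replace ((INR n * a) ^ 2 * (v / INR n)) with (INR n * (a ^ 2 * v)) by (field; lra).
    apply Rmult_le_compat_l with (r := INR n) in h6; [|lra]. nra.
Qed.

(** Squaring [1 - y/2 <= exp (-y/2)] gives [(1 - y/2)^2 exp y <= 1]. The coefficient 4/5 exceeds the
    3/4 of the expansion of [(1 - y/2)^(-2)], which leaves room for the cubic term when [y] is
    small. *)
Lemma exp_le_quadratic y : -(1/100) <= y <= 1/100 -> exp y <= 1 + y + 4 / 5 * y ^ 2.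
Proof.
  intros hy.
  assert (h : 0 < 1 - y / 2 <= exp (- (y / 2))).
  { pose proof (exp_ineq1_le (- (y / 2))). lra. }
  assert (he : exp (- (y / 2)) * exp (- (y / 2)) * exp y = 1).
  { rewrite <- !exp_plus. replace (- (y / 2) + - (y / 2) + y) with 0 by field.
    apply exp_0. }
  assert (hp := exp_pos y).
  assert ((1 - y / 2) ^ 2 * exp y <= 1).
  { rewrite <- he. apply Rmult_le_compat_r; [lra|]. nra. }
  apply Rmult_le_reg_l with ((1 - y / 2) ^ 2); [nra|].
  apply Rle_trans with (1 := H).
  assert (0 <= y ^ 2 * (1/20 - 11/20 * y)) by nra.
  assert (0 <= (y ^ 2) ^ 2) by nra. nra.
Qed.

(** The exponent is optimised at [t = 5a / 8S], where [S] bounds the second moment. *)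
Lemma sum_err_chernoff l a v n :
  good l a v -> 1 / a <= (1 + v) / 100 ->
  sum_err l n <= exp (- (5 / 16 * INR n / (1 + v))).
Proof.
  intros [h1 h2 h3 h4 h5 h6] hav.
  set (S := a ^ 2 * (1 + v)) in *.
  assert (hS : 0 < S) by (unfold S; apply Rmult_lt_0_compat; nra).
  set (t := 5 / 8 * a / S).
  assert (ht0 : 0 < t) by (unfold t; apply Rdiv_lt_0_compat; lra).
  (* The hypothesis on [1 / a] serves here: with entries in [-1, 1] it keeps [t x] in the range of
     [exp_le_quadratic]. *)
  assert (ht : t <= 1 / 100).
  { unfold t. apply Rmult_le_reg_r with S; [exact hS|].
    replace (5 / 8 * a / S * S) with (5 / 8 * a) by (field; lra).
    apply Rmult_le_compat_l with (r := a ^ 2) in hav; [|nra].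
    replace (a ^ 2 * (1 / a)) with a in hav by (field; lra).
    unfold S. lra. }
  apply Rle_trans with (expect (iid l n) (fun v => exp (- t * sum v))).
  { apply expect_le with (P := fun _ => True);
      [now apply is_law_iid|intros ? ? ?; exact I|].
    intros x _. apply err_ind_chernoff. lra. }
  rewrite expect_exp_sum.
  replace (exp (- (5 / 16 * INR n / (1 + v)))) with (exp (- (5 / 16 / (1 + v))) ^ n).
  2:{ rewrite <- Rpower_pow by apply exp_pos. unfold Rpower. rewrite ln_exp.
      f_equal. field. lra. }
  apply pow_incr. split.
  { replace 0 with (expect l (fun _ => 0)) by now apply expect_const.
    apply expect_le with (1 := h1) (2 := h2). intros. apply Rlt_le, exp_pos. }
  apply Rle_trans with (expect l (fun x => 1 + (- t * x + 4 / 5 * t ^ 2 * x ^ 2))).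
  { apply expect_le with (1 := h1) (2 := h2). intros x hx.
    apply Rle_trans with (1 := exp_le_quadratic (- t * x) ltac:(split; nra)). right. ring. }
  rewrite !expect_plus, !expect_scal, !expect_const, h3 by exact h1.
  apply Rle_trans with (1 + (- t * a + 4 / 5 * t ^ 2 * S)).
  { apply Rplus_le_compat_l, Rplus_le_compat_l, Rmult_le_compat_l; [nra|exact h6]. }
  (* At this [t] the bracket equals [-5 a^2 / (16 S)], since 5/8 - (4/5)(25/64) = 5/16. *)
  replace (1 + (- t * a + 4 / 5 * t ^ 2 * S)) with (1 + - (5 / 16 / (1 + v))).
  - apply exp_ineq1_le.
  - unfold t, S. field. lra.
Qed.

(** * Relative variance along a path *)

(** For [n = 2^k], the relative variance after [k] consecutive steps 0. *)
Definition gain (n : nat) (v : R) : R := (1 + v) ^ n - 1.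

(** As a function of [v >= 0], [gain n] is convex and vanishes at 0. *)
Lemma gain_half n v : 0 <= v -> gain n (v / 2) <= gain n v / 2.
Proof.
  intros hv. unfold gain. induction n as [|n IH]; simpl; [lra|].
  pose proof (pow_R1_Rle (1 + v) n ltac:(lra)).
  set (X := (1 + v) ^ n) in *. set (Y := (1 + v / 2) ^ n) in *.
  assert (0 <= X * v) by nra. assert (0 <= (X - 1) * v) by nra.
  assert ((1 + v / 2) * Y <= (1 + v / 2) * ((X + 1) / 2)) by
    (apply Rmult_le_compat_l; lra). nra.
Qed.

Lemma gain_ge n v : 0 <= v -> (1 <= n)%nat -> v <= gain n v.
Proof.
  intros hv hn. unfold gain. destruct n as [|n]; [lia|]. simpl.
  pose proof (pow_R1_Rle (1 + v) n ltac:(lra)). nra.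
Qed.

Lemma gain_sqr n v : gain n ((1 + v) ^ 2 - 1) = gain (2 * n) v.
Proof.
  unfold gain. rewrite pow_mult. f_equal. f_equal. ring.
Qed.

Lemma count_occ_full t :
  (length t <= count_occ Bool.bool_dec t true)%nat -> t = repeat true (length t).
Proof.
  induction t as [|b t IH]; simpl; [reflexivity|].
  pose proof (count_occ_bound Bool.bool_dec true t) as hb.
  destruct (Bool.bool_dec b true) as [->|hn]; intros h; [|lia].
  rewrite <- IH by lia. reflexivity.
Qed.

Lemma nat_pow2_pos n : (1 <= 2 ^ n)%nat.
Proof. induction n; simpl; lia. Qed.

(** The relative variance [v] of the entries is squared-and-shifted by a step 0
    and halved by a step 1; by [gain_half], delaying steps 1 past steps 0 can only
    increase the final value, so steps 0 may be charged first.  [c] counts the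
    steps 1 that occur before the last step 0. *)
Lemma path_cases m r xi l a v :
  good l a v -> (1 <= r < m)%nat -> length xi = m ->
  (m - r <= count_occ Bool.bool_dec xi true)%nat ->
  path_err l m r xi <= gain (2 ^ (r - 1)) v / 2 ^ (m - r) \/
  exists c l', (c <= m - r)%nat /\ (c = O -> xi = xi_star m r) /\
    good l' (a ^ (2 ^ r)) ((1 + gain (2 ^ (r - 1)) v / 2 ^ c) ^ 2 - 1) /\
    path_err l m r xi = sum_err l' (2 ^ (m - r - c)).
Proof.
  revert r xi l a v. induction m as [|m IH]; intros r xi l a v hg hr hlen hcount; [lia|].
  destruct xi as [|b t]; [discriminate|]. injection hlen as hlen.
  destruct b.
  - rewrite count_occ_cons_eq in hcount by reflexivity.
    pose proof (good_mean2 _ _ _ hg) as hg'.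
    pose proof (good_var_pos _ _ _ hg) as hv.
    rewrite path_err_true by lia.
    (* A step 0 preserves [m - r], so a right-end node is entered only by a step 1, as happens
       here. *)
    destruct (Nat.eq_dec r m) as [<-|hrm].
    + left. rewrite path_err_diag by (try apply hg'; lia).
      replace (S r - r)%nat with 1%nat by lia. rewrite pow_1.
      apply Rle_trans with (1 := err_chebyshev _ _ _ hg').
      pose proof (gain_ge (2 ^ (r - 1)) v hv (nat_pow2_pos _)). lra.
    + pose proof (gain_half (2 ^ (r - 1)) v hv) as hh.
      replace (S m - r)%nat with (S (m - r)) by lia.
      destruct (IH r t _ _ _ hg' ltac:(lia) hlen ltac:(lia))
        as [h|(c & l' & hc & _ & hl' & h)].
      * left. apply Rle_trans with (1 := h). simpl pow.

        replace (gain (2 ^ (r - 1)) v / (2 * 2 ^ (m - r))) with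
          (gain (2 ^ (r - 1)) v / 2 / 2 ^ (m - r)) by (field; apply pow_nonzero; lra).
        apply Rmult_le_compat_r; [apply Rlt_le, Rinv_0_lt_compat, pow_lt; lra|exact hh].
      (* The leading step 1 precedes a step 0, so it raises [c], and [c = 0] is excluded. Its
         halving is moved past the first [r - 1] steps 0. *)
      * right. exists (S c), l'. split; [lia|]. split; [discriminate|]. split.
        -- apply good_le with (1 := hl').
           assert (hc2 : 0 < 2 ^ c) by (apply pow_lt; lra).
           assert (hx : gain (2 ^ (r - 1)) (v / 2) / 2 ^ c <= gain (2 ^ (r - 1)) v / 2 ^ S c).
           { simpl pow. replace (gain (2 ^ (r - 1)) v / (2 * 2 ^ c)) with
               (gain (2 ^ (r - 1)) v / 2 / 2 ^ c) by (field; lra).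
             apply Rmult_le_compat_r; [apply Rlt_le, Rinv_0_lt_compat; lra|exact hh]. }
           assert (0 <= gain (2 ^ (r - 1)) (v / 2) / 2 ^ c).
           { apply Rmult_le_pos;
              [|apply Rlt_le, Rinv_0_lt_compat; lra].
             pose proof (gain_ge (2 ^ (r - 1)) (v / 2) ltac:(lra) (nat_pow2_pos _)). lra. }
           apply Rplus_le_compat_r. apply pow_incr. lra.
        -- rewrite h. f_equal.
  - rewrite count_occ_cons_neq in hcount by discriminate.
    pose proof (good_mult _ _ _ hg) as hg'.
    destruct r as [|r]; [lia|].
    rewrite path_err_false by lia.
    replace (S m - S r)%nat with (m - r)%nat in * by lia.
    replace (S r - 1)%nat with r by lia.
    (* In the first case this is the last step 0 and leads to a repetition node. It supplies the
       outer square in the claim, which is why [gain] only counts [r - 1] steps; the weight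
       condition forces the rest of the path to consist of steps 1. *)
    destruct r as [|r].
    + right. exists O, (lift2 Rmult l).
      split; [lia|]. split; [|split].
      * intros _. rewrite (count_occ_full t) by lia. unfold xi_star. simpl.
        now rewrite hlen, Nat.sub_0_r.
      * replace (gain (2 ^ 0) v / 2 ^ 0) with v by (unfold gain; simpl; field).
        exact hg'.
      * rewrite path_err_rep. now rewrite !Nat.sub_0_r.
    + assert (hgain : gain (2 ^ (S r - 1)) ((1 + v) ^ 2 - 1) = gain (2 ^ S r) v).
      { rewrite gain_sqr. replace (S r - 1)%nat with r by lia. reflexivity. }
      destruct (IH (S r) t _ _ _ hg' ltac:(lia) hlen ltac:(lia))
        as [h|(c & l' & hc & h0 & hl' & h)]; rewrite hgain in *; [now left|].
      right. exists c, l'. split; [exact hc|]. split.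
      * intros hc0. rewrite (h0 hc0). unfold xi_star. reflexivity.
      * split; [|exact h].
        replace (a ^ 2 ^ S (S r)) with ((a ^ 2) ^ 2 ^ S r); [exact hl'|].
        rewrite <- pow_mult. f_equal.
Qed.

(** Needed because laws with equal expectations may be different lists: the product of two signs has
    four atoms in [lift2], but only two values. *)
Lemma iid_ext l k n f :
  (forall f, expect l f = expect k f) -> expect (iid l n) f = expect (iid k n) f.
Proof.
  intros h. revert f. induction n as [|n IH]; intros f; [reflexivity|].
  rewrite !expect_iid_S, h. apply expect_ext; intros x. apply IH.
Qed.

(** A product of two independent signs of mean [e] is a sign of mean [e^2], so [r] steps 0 keep the
    law within the family [signs]. *)
Lemma path_err_signs e r k t :
  (1 <= k)%nat ->
  path_err (signs e) (r + k) r (repeat false r ++ t) = sum_err (signs (e ^ 2 ^ r)) (2 ^ k).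
Proof.
  intros hk. revert e. induction r as [|r IH]; intros e.
  - rewrite path_err_rep. simpl. now rewrite Rmult_1_r.
  - simpl Nat.add. simpl repeat. simpl app. rewrite path_err_false by lia.
    replace (e ^ 2 ^ S r) with ((e ^ 2) ^ 2 ^ r).
    + rewrite <- IH. apply iid_ext. intros f.
      rewrite expect_lift2, !expect_signs.
      replace (-1 * -1) with 1 by ring. replace (-1 * 1) with (-1) by ring.
      replace (1 * -1) with (-1) by ring. replace (1 * 1) with 1 by ring. field.
    + rewrite <- pow_mult. f_equal.
Qed.

(** * The lower tail of a sum of independent signs *)

(** Binomial coefficients by Pascal's recursion; they vanish for [k > n], so sums can be extended by
    null terms. *)
Fixpoint choose (n k : nat) : R :=
  match n, k with
  | _, O => 1
  | O, S _ => 0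
  | S n', S k' => choose n' k' + choose n' (S k')
  end.

Lemma choose_0 n : choose n 0 = 1.
Proof. destruct n; reflexivity. Qed.

Lemma choose_gt n k : (n < k)%nat -> choose n k = 0.
Proof.
  revert k. induction n as [|n IH]; intros [|k] h; simpl; try lia; [reflexivity|].
  rewrite !IH by lia. ring.
Qed.

Lemma choose_absorb n k :
  choose n (S k) * INR (S k) = (INR n - INR k) * choose n k.
Proof.
  revert k. induction n as [|n IH]; intros k.
  - destruct k; simpl choose; [simpl; ring|ring].
  - change (choose (S n) (S k)) with (choose n k + choose n (S k)).
    destruct k as [|k].
    + specialize (IH O). rewrite !choose_0, !S_INR in *.
      change (INR 1) with 1 in *. change (INR 0) with 0 in *. lra.
    + change (choose (S n) (S k)) with (choose n k + choose n (S k)).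
      pose proof (IH k) as h1. pose proof (IH (S k)) as h2.
      rewrite !S_INR in *. lra.
Qed.

Lemma choose_pos n k : (k <= n)%nat -> 0 < choose n k.
Proof.
  revert k. induction n as [|n IH]; intros [|k] h; simpl; try lia; try lra.
  pose proof (IH k ltac:(lia)).
  destruct (Nat.eq_dec k n) as [->|hn]; [rewrite (choose_gt n (S n)) by lia; lra|].
  pose proof (IH (S k) ltac:(lia)). lra.
Qed.

Lemma choose_central_S n :
  choose (2 * S n) (S n) * (INR n + 1) = 2 * (2 * INR n + 1) * choose (2 * n) n.
Proof.
  replace (2 * S n)%nat with (S (S (2 * n))) by lia.
  change (choose (S (S (2 * n))) (S n)) with
    (choose (S (2 * n)) n + choose (S (2 * n)) (S n)).
  pose proof (choose_absorb (S (2 * n)) n) as h1.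
  pose proof (choose_absorb (2 * n) n) as h2.
  change (choose (S (2 * n)) (S n)) with (choose (2 * n) n + choose (2 * n) (S n)) in *.
  rewrite !S_INR, mult_INR in *. change (INR 2) with 2 in *.
  pose proof (pos_INR n).
  assert (h3 : choose (S (2 * n)) n = choose (2 * n) n + choose (2 * n) (S n)).
  { apply Rmult_eq_reg_r with (INR n + 1); lra. }
  rewrite h3. lra.
Qed.

Lemma sum_f_R0_scal c a n : sum_f_R0 (fun i => c * a i) n = c * sum_f_R0 a n.
Proof. induction n as [|n IH]; simpl; [reflexivity|rewrite IH; ring]. Qed.

(** Binomial law of the sum, with [k] the number of entries equal to -1; the induction is Pascal's
    recursion. *)
Lemma expect_iid_signs d n G :
  expect (iid (signs d) n) (fun v => G (sum v)) =
  sum_f_R0 (fun k => choose n k * ((1 - d) / 2) ^ k * ((1 + d) / 2) ^ (n - k)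
                     * G (INR n - 2 * INR k)) n.
Proof.
  set (q := (1 - d) / 2). set (p := (1 + d) / 2). revert G.
  induction n as [|n IH]; intros G.
  - rewrite expect_iid_0. unfold sum; simpl.
    replace (0 - 2 * 0) with 0 by ring. ring.
  - rewrite expect_iid_S, expect_signs. fold p q. unfold sum; simpl fold_right.
    change (fold_right Rplus 0) with sum.
    rewrite (IH (fun x => G (-1 + x))), (IH (fun x => G (1 + x))).
    set (a := fun k => choose n k * q ^ k * p ^ (n - k) * G (INR n + 1 - 2 * INR k)).
    (* The null term [k = S n] is added so that, after the [k = 0] terms are split off, both sums
       run over the same shifted index. *)
    assert (h1 : p * sum_f_R0 (fun k => choose n k * q ^ k * p ^ (n - k) *
                   G (1 + (INR n - 2 * INR k))) n = p * sum_f_R0 a (S n)).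
    { rewrite tech5. unfold a at 2. rewrite (choose_gt n (S n)) by lia.
      rewrite (sum_eq _ a); [ring|]. intros i _. unfold a.
      f_equal. f_equal. ring. }
    rewrite h1, (decomp_sum a (S n)), (decomp_sum _ (S n)) by lia. simpl pred.
    unfold a at 1. rewrite !choose_0, !Nat.sub_0_r.
    rewrite Rmult_plus_distr_l, (Rplus_comm (q * _)), Rplus_assoc.
    f_equal.
    + rewrite S_INR. simpl pow. ring.
    + rewrite <- !sum_f_R0_scal, <- plus_sum. apply sum_eq. intros i hi.
      unfold a.
      change (choose (S n) (S i)) with (choose n i + choose n (S i)).
      replace (S n - S i)%nat with (n - i)%nat by lia. rewrite !S_INR.
      replace (-1 + (INR n - 2 * INR i)) with (INR n + 1 - 2 * (INR i + 1)) by ring.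
      destruct (Nat.eq_dec i n) as [->|hn].
      * rewrite (choose_gt n (S n)) by lia. simpl pow. ring.
      * replace (n - i)%nat with (S (n - S i)) by lia. simpl pow. ring.
Qed.

(** The quotient of consecutive ratios is [1 - (2i+1)/(M+i+1)]. Each ratio being at most 1, a step
    loses at most [(2i+1)/M], and the odd numbers add up to [i^2]. *)
Lemma choose_ratio M i : (i <= M)%nat -> (1 <= M)%nat ->
  1 - INR i ^ 2 / INR M <= choose (2 * M) (M + i) / choose (2 * M) M <= 1.
Proof.
  intros hi hM. pose proof (choose_pos (2 * M) M ltac:(lia)) as h0.
  assert (hM' : 1 <= INR M) by (change 1 with (INR 1); now apply le_INR).
  induction i as [|i IH].
  - rewrite Nat.add_0_r. replace (choose (2 * M) M / choose (2 * M) M) with 1 by (field; lra).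
    simpl INR. split; [|lra]. right. field. lra.
  - specialize (IH ltac:(lia)).
    set (x := choose (2 * M) (M + i) / choose (2 * M) M) in *.
    assert (hx : 0 < x).
    { apply Rdiv_lt_0_compat; [apply choose_pos; lia|exact h0]. }
    assert (hrec : choose (2 * M) (M + S i) / choose (2 * M) M =
                   x - x * (2 * INR i + 1) / (INR M + INR i + 1)).
    { pose proof (choose_absorb (2 * M) (M + i)) as h. pose proof (pos_INR i).
      rewrite S_INR, plus_INR, mult_INR in h. change (INR 2) with 2 in h.
      replace (M + S i)%nat with (S (M + i)) by lia.
      replace (choose (2 * M) (S (M + i))) with
        ((2 * INR M - (INR M + INR i)) * choose (2 * M) (M + i) / (INR M + INR i + 1)).
      - unfold x. field. lra.
      - apply Rmult_eq_reg_r with (INR M + INR i + 1); [|lra].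
        rewrite h. field. lra. }
    rewrite hrec. pose proof (pos_INR i) as hi0.
    split.
    + apply Rle_trans with (x - 1 * (2 * INR i + 1) / INR M).
      * rewrite S_INR. unfold Rdiv in *. nra.
      * apply Rplus_le_compat_l, Ropp_le_contravar.
        apply Rmult_le_compat; [nra| |nra|].
        -- apply Rlt_le, Rinv_0_lt_compat. lra.
        -- apply Rinv_le_contravar; lra.
    + assert (0 <= x * (2 * INR i + 1) / (INR M + INR i + 1)); [|lra].
      apply Rmult_le_pos; [nra|]. apply Rlt_le, Rinv_0_lt_compat. lra.
Qed.

Lemma geom_sum x n : x <> 1 ->
  sum_f_R0 (fun i => x ^ S i) n = (x - x ^ S (S n)) / (1 - x).
Proof.
  intros hx. induction n as [|n IH]; [simpl; field; lra|].
  rewrite tech5, IH. simpl pow. field. lra.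
Qed.

(** Telescoping: [i^2 x^i = x^i Q(i) - x^(i+1) Q(i+1)] for this quadratic [Q]. *)
Lemma geom_sqr_sum x n : x <> 1 ->
  let Q (t : R) := t ^ 2 / (1 - x) + 2 * t * x / (1 - x) ^ 2 + x * (1 + x) / (1 - x) ^ 3 in
  sum_f_R0 (fun i => INR (S i) ^ 2 * x ^ S i) n = Q 0 - x ^ S (S n) * Q (INR (S (S n))).
Proof.
  intros hx Q. unfold Q. induction n as [|n IH].
  - simpl. field. lra.
  - rewrite tech5, IH, !(S_INR (S _)). generalize (INR (S n)); intros t.
    simpl pow. field. lra.
Qed.

(** With [M + i] entries equal to -1 the sum is [-2i]. The tie [i = 0] counts one half, and taking
    out the factor of the tie leaves a power of [(1-d)/(1+d)]. *)
Lemma sum_err_signs M d : (1 <= M)%nat -> 0 < d < 1 ->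
  sum_err (signs d) (2 * M) =
  choose (2 * M) M / 4 ^ M * (1 - d ^ 2) ^ M *
  (/ 2 + sum_f_R0 (fun i => choose (2 * M) (M + S i) / choose (2 * M) M
                            * ((1 - d) / (1 + d)) ^ S i) (M - 1)).
Proof.
  intros hM hd. unfold sum_err. rewrite expect_iid_signs.
  set (q := (1 - d) / 2). set (p := (1 + d) / 2).
  pose proof (choose_pos (2 * M) M ltac:(lia)) as h0.
  assert (hpq : choose (2 * M) M / 4 ^ M * (1 - d ^ 2) ^ M =
                choose (2 * M) M * (q ^ M * p ^ M)).
  { unfold Rdiv. rewrite Rmult_assoc. f_equal.
    rewrite <- pow_inv, <- !Rpow_mult_distr. f_equal. unfold p, q. field. }
  rewrite hpq, (tech2 _ M) by lia. rewrite Rmult_plus_distr_l. f_equal.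
  - destruct M as [|M]; [lia|]. rewrite tech5, (sum_eq _ (fun _ => 0)).
    + rewrite sum_cte. replace (2 * S M - S M)%nat with (S M) by lia.
      rewrite mult_INR. change (INR 2) with 2.
      replace (2 * INR (S M) - 2 * INR (S M)) with 0 by ring.
      unfold err_ind. destruct (Rlt_dec 0 0); [lra|]. destruct (Req_EM_T 0 0); [|lra].
      ring.
    + intros i hi. rewrite mult_INR. change (INR 2) with 2.
      assert (INR i < INR (S M)) by (apply lt_INR; lia).
      unfold err_ind. destruct (Rlt_dec _ 0); [lra|]. destruct (Req_EM_T _ 0); [lra|ring].
  - rewrite <- sum_f_R0_scal. replace (2 * M - S M)%nat with (M - 1)%nat by lia.
    apply sum_eq. intros i hi.
    replace (S M + i)%nat with (M + S i)%nat by lia.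
    replace (err_ind _) with 1.
    + replace (2 * M - (M + S i))%nat with (M - S i)%nat by lia.
      rewrite pow_add.
      replace (p ^ M) with (p ^ (M - S i) * p ^ S i)
        by (rewrite <- pow_add; f_equal; lia).
      replace ((1 - d) / (1 + d)) with (q * / p) by (unfold p, q; field; lra).
      rewrite Rpow_mult_distr, pow_inv. field. split.
      * apply pow_nonzero. unfold p. lra.
      * lra.
    + unfold err_ind. rewrite mult_INR, plus_INR. change (INR 2) with 2. rewrite S_INR.
      pose proof (pos_INR i). destruct (Rlt_dec _ 0); [reflexivity|lra].
Qed.

(** The complete geometric series gives [1/2 + x/(1-x) = 1/(2d)]. The correction from [choose_ratio]
    costs at most [2/(M d^3)], which is [4/(M d^2)] relative to [1/(2d)]. *)
Lemma sum_err_signs_bounds M d : (1 <= M)%nat -> 0 < d < 1 ->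
  let main := choose (2 * M) M / 4 ^ M * (1 - d ^ 2) ^ M / (2 * d) in
  (1 - 4 / (INR M * d ^ 2)) * main <= sum_err (signs d) (2 * M) <= main.
Proof.
  intros hM hd main. rewrite sum_err_signs by assumption.
  set (x := (1 - d) / (1 + d)).
  set (s := sum_f_R0 _ _).
  set (A := choose (2 * M) M / 4 ^ M * (1 - d ^ 2) ^ M) in *.
  assert (hA : 0 <= A).
  { apply Rmult_le_pos; [|apply pow_le; nra].
    apply Rlt_le, Rdiv_lt_0_compat; [apply choose_pos; lia|apply pow_lt; lra]. }
  assert (hM' : 1 <= INR M) by (change 1 with (INR 1); now apply le_INR).
  assert (hu : 1 - x = 2 * d / (1 + d)) by (unfold x; field; lra).
  assert (hx0 : 0 < x) by (apply Rdiv_lt_0_compat; lra).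
  assert (hud : d <= 1 - x).
  { rewrite hu. apply Rmult_le_reg_r with (1 + d); [lra|].
    replace (2 * d / (1 + d) * (1 + d)) with (2 * d) by (field; lra). nra. }
  assert (hxu : / 2 + x / (1 - x) = / (2 * d)) by (unfold x; field; lra).
  assert (hgeom := geom_sum x (M - 1) ltac:(lra)).
  assert (hsqr := geom_sqr_sum x (M - 1) ltac:(lra)). cbv zeta in hsqr.
  replace (S (S (M - 1))) with (S M) in * by lia.
  set (Q := INR (S M) ^ 2 / (1 - x) + 2 * INR (S M) * x / (1 - x) ^ 2
            + x * (1 + x) / (1 - x) ^ 3) in *.
  assert (hxM : 0 < x ^ S M) by (now apply pow_lt).
  assert (hup : s <= x / (1 - x)).
  { apply Rle_trans with (sum_f_R0 (fun i => x ^ S i) (M - 1)).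
    - apply sum_Rle. intros i hi.
      rewrite <- (Rmult_1_l (x ^ S i)) at 2. apply Rmult_le_compat_r.
      + apply pow_le; lra.
      + apply choose_ratio; lia.
    - rewrite hgeom. apply Rmult_le_compat_r; [apply Rlt_le, Rinv_0_lt_compat; lra|lra]. }
  assert (hlow : x / (1 - x) - 2 / (INR M * d ^ 3) <= s).
  { apply Rle_trans with (sum_f_R0 (fun i => x ^ S i + - / INR M * (INR (S i) ^ 2 * x ^ S i))
                            (M - 1)).
    - rewrite plus_sum, sum_f_R0_scal, hgeom, hsqr.
      (* The boundary term of the quadratic sum has a favourable sign; this bound makes it pay for
         the missing tail [x^(M+1)/(1-x)] of the geometric series. *)
      assert (hQ : INR M / (1 - x) <= Q).
      { unfold Q. apply Rle_trans with (INR (S M) ^ 2 / (1 - x)).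
        - apply Rmult_le_compat_r; [apply Rlt_le, Rinv_0_lt_compat; lra|].
          rewrite S_INR. nra.
        - assert (0 <= 2 * INR (S M) * x / (1 - x) ^ 2).
          { apply Rmult_le_pos; [pose proof (pos_INR (S M)); nra|].
            apply Rlt_le, Rinv_0_lt_compat, pow_lt. lra. }
          assert (0 <= x * (1 + x) / (1 - x) ^ 3).
          { apply Rmult_le_pos; [nra|].
            apply Rlt_le, Rinv_0_lt_compat, pow_lt. lra. }
          lra. }
      replace ((0 ^ 2 / (1 - x) + 2 * 0 * x / (1 - x) ^ 2 + x * (1 + x) / (1 - x) ^ 3))
        with (x * (1 + x) / (1 - x) ^ 3) by (field; lra).
      replace ((x - x ^ S M) / (1 - x)) with (x / (1 - x) - x ^ S M * / (1 - x))
        by (field; lra).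
      assert (h1 : x ^ S M * / (1 - x) <= / INR M * (x ^ S M * Q)).
      { apply Rle_trans with (/ INR M * (x ^ S M * (INR M / (1 - x)))).
        - right. field. lra.
        - apply Rmult_le_compat_l; [apply Rlt_le, Rinv_0_lt_compat; lra|].
          apply Rmult_le_compat_l; lra. }
      assert (h2 : / INR M * (x * (1 + x) / (1 - x) ^ 3) <= 2 / (INR M * d ^ 3)).
      { replace (2 / (INR M * d ^ 3)) with (/ INR M * (2 / d ^ 3)) by (field; lra).
        apply Rmult_le_compat_l; [apply Rlt_le, Rinv_0_lt_compat; lra|].
        apply Rmult_le_compat; [nra| |nra|].
        - apply Rlt_le, Rinv_0_lt_compat, pow_lt. lra.
        - apply Rinv_le_contravar; [apply pow_lt; lra|apply pow_incr; lra]. }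
      lra.
    - apply sum_Rle. intros i hi.
      pose proof (proj1 (choose_ratio M (S i) ltac:(lia) hM)) as hr.
      apply Rle_trans with ((1 - INR (S i) ^ 2 / INR M) * x ^ S i).
      + right. unfold Rdiv. ring.
      + apply Rmult_le_compat_r; [apply pow_le; lra|exact hr]. }
  replace main with (A * / (2 * d)) by reflexivity. split.
  - replace ((1 - 4 / (INR M * d ^ 2)) * (A * / (2 * d))) with
      (A * (/ (2 * d) - 2 / (INR M * d ^ 3))) by (field; lra).
    apply Rmult_le_compat_l; [exact hA|]. lra.
  - apply Rmult_le_compat_l; [exact hA|]. lra.
Qed.

(** * Wallis integrals and the central binomial coefficient *)

Definition wallis (n : nat) : R := RInt (fun x => sin x ^ n) 0 (PI / 2).

Lemma ex_RInt_sin_pow n a b : ex_RInt (fun x => sin x ^ n) a b.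
Proof.
  apply (ex_RInt_continuous (V := R_CompleteNormedModule)). intros x _.
  apply (ex_derive_continuous (V := R_NormedModule)). auto_derive. exact I.
Qed.

(** The difference of the two integrands is the derivative of [- cos x * sin x ^ (n+1)], which
    vanishes at both ends. *)
Lemma wallis_rec n : (INR n + 2) * wallis (S (S n)) = (INR n + 1) * wallis n.
Proof.
  set (df := fun x => (INR n + 2) * sin x ^ S (S n) - (INR n + 1) * sin x ^ n).
  assert (h1 : is_RInt df 0 (PI / 2)
    (minus (- cos (PI / 2) * sin (PI / 2) ^ S n) (- cos 0 * sin 0 ^ S n))).
  { apply (is_RInt_derive (fun x => - cos x * sin x ^ S n)).
    - intros x _. unfold df. auto_derive; [exact I|].
      change (pred (S n)) with n.
      pose proof (sin2_cos2 x) as h. unfold Rsqr in h.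
      replace (match n with 0%nat => 1 | S _ => INR n + 1 end) with (INR n + 1)
        by (destruct n; simpl; ring).
      assert (hc : cos x * cos x = 1 - sin x * sin x) by lra.
      simpl pow.
      transitivity (sin x * (sin x * sin x ^ n) - (INR n + 1) * sin x ^ n * (cos x * cos x));
        [ring|rewrite hc; ring].
    - intros x _. apply (ex_derive_continuous (V := R_NormedModule)).
      unfold df. auto_derive. exact I. }
  assert (h2 : is_RInt df 0 (PI / 2)
    (minus (scal (INR n + 2) (wallis (S (S n)))) (scal (INR n + 1) (wallis n)))).
  { apply (is_RInt_minus (V := R_NormedModule)); apply (is_RInt_scal (V := R_NormedModule));
      apply (RInt_correct (V := R_CompleteNormedModule)); apply ex_RInt_sin_pow. }
  pose proof (is_RInt_unique _ _ _ _ h1) as e1.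
  pose proof (is_RInt_unique _ _ _ _ h2) as e2. rewrite e1 in e2.
  rewrite cos_PI2, sin_0 in e2. rewrite pow_i in e2 by lia.
  unfold minus, plus, opp, scal in e2; simpl in e2; unfold mult in e2; simpl in e2. lra.
Qed.

Lemma wallis_0 : wallis 0 = PI / 2.
Proof.
  unfold wallis. simpl. rewrite RInt_const. unfold scal; simpl; unfold mult; simpl. ring.
Qed.

Lemma wallis_1 : wallis 1 = 1.
Proof.
  unfold wallis. apply is_RInt_unique.
  replace 1 with (minus (- cos (PI / 2)) (- cos 0)).
  - apply (is_RInt_derive (fun x => - cos x)).
    + intros x _. auto_derive; [exact I|ring].
    + intros x _. apply (ex_derive_continuous (V := R_NormedModule)).
      auto_derive. exact I.
  - rewrite cos_PI2, cos_0. unfold minus, plus, opp; simpl. ring.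
Qed.

Lemma wallis_S_le n : 0 <= wallis (S n) <= wallis n.
Proof.
  assert (hpi := PI_RGT_0).
  assert (hs : forall x, 0 < x < PI / 2 -> 0 <= sin x <= 1).
  { intros x hx. split; [apply sin_ge_0; lra|apply SIN_bound]. }
  split.
  - apply RInt_ge_0; [lra|apply ex_RInt_sin_pow|].
    intros x hx. apply pow_le. now apply hs.
  - apply RInt_le; [lra|apply ex_RInt_sin_pow|apply ex_RInt_sin_pow|].
    intros x hx. destruct (hs x hx) as [h0 h1]. simpl.
    pose proof (pow_le (sin x) n h0). nra.
Qed.

(** The recursion makes this product independent of [n]. *)
Lemma wallis_mult n : (INR n + 1) * (wallis n * wallis (S n)) = PI / 2.
Proof.
  induction n as [|n IH].
  - rewrite wallis_0, wallis_1. simpl. ring.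
  - pose proof (wallis_rec n) as h. rewrite S_INR.
    replace ((INR n + 1 + 1) * (wallis (S n) * wallis (S (S n)))) with
      (wallis (S n) * ((INR n + 2) * wallis (S (S n)))) by ring.
    rewrite h, <- IH. ring.
Qed.

Lemma wallis_even n : wallis (2 * n) = PI / 2 * (choose (2 * n) n / 4 ^ n).
Proof.
  induction n as [|n IH].
  - simpl Nat.mul. rewrite wallis_0. simpl. field.
  - pose proof (wallis_rec (2 * n)) as h. rewrite IH in h.
    replace (S (S (2 * n))) with (2 * S n)%nat in h by lia.
    rewrite mult_INR in h. change (INR 2) with 2 in h.
    pose proof (choose_central_S n) as hc. pose proof (pos_INR n) as hn.
    apply Rmult_eq_reg_l with (2 * INR n + 2); [|lra]. rewrite h.
    replace ((2 * INR n + 2) * (PI / 2 * (choose (2 * S n) (S n) / 4 ^ S n))) with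
      (PI / 4 ^ S n * (choose (2 * S n) (S n) * (INR n + 1)))
      by (field; apply pow_nonzero; lra).
    rewrite hc. simpl pow. field. apply pow_nonzero. lra.
Qed.

(** By monotonicity the square of [wallis (2n)] lies between its products with the next and the
    previous integral, which [wallis_mult] evaluates. This gives [2n/(2n+1) <= w^2 <= 1]. *)
Lemma central_choose_bounds n : (1 <= n)%nat ->
  1 - / INR n <= choose (2 * n) n / 4 ^ n * sqrt (PI * INR n) <= 1.
Proof.
  intros hn.
  assert (hn' : 1 <= INR n) by (change 1 with (INR 1); now apply le_INR).
  assert (hpi := PI_RGT_0).
  set (w := choose (2 * n) n / 4 ^ n * sqrt (PI * INR n)).
  assert (hw0 : 0 <= w).
  { apply Rmult_le_pos; [|apply sqrt_pos].
    apply Rlt_le, Rdiv_lt_0_compat; [apply choose_pos; lia|apply pow_lt; lra]. }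
  assert (hw : PI * w ^ 2 = 4 * INR n * wallis (2 * n) ^ 2).
  { unfold w. rewrite wallis_even, Rpow_mult_distr, pow2_sqrt by nra. field.
    apply pow_nonzero. lra. }
  pose proof (wallis_S_le (2 * n)) as h1.
  pose proof (wallis_mult (2 * n)) as h2.
  pose proof (wallis_S_le (2 * n - 1)) as h3.
  pose proof (wallis_mult (2 * n - 1)) as h4.
  replace (S (2 * n - 1)) with (2 * n)%nat in * by lia.
  rewrite minus_INR in h4 by lia.
  rewrite mult_INR in *. change (INR 2) with 2 in *. change (INR 1) with 1 in *.
  set (J := wallis (2 * n)) in *.
  assert (hup : w ^ 2 <= 1).
  { apply Rmult_le_reg_l with PI; [exact hpi|]. rewrite hw.
    assert (J * J <= wallis (2 * n - 1) * J) by nra. nra. }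
  assert (hlow : 1 - / INR n <= w ^ 2).
  { apply Rmult_le_reg_l with PI; [exact hpi|]. rewrite hw.
    assert (hJ : PI / 2 <= (2 * INR n + 1) * J ^ 2).
    { rewrite <- h2. apply Rmult_le_compat_l; [lra|]. nra. }
    apply Rle_trans with (PI * (2 * INR n / (2 * INR n + 1))).
    - apply Rmult_le_compat_l; [lra|].
      apply Rmult_le_reg_r with (INR n * (2 * INR n + 1)); [nra|].
      replace ((1 - / INR n) * (INR n * (2 * INR n + 1))) with
        ((INR n - 1) * (2 * INR n + 1)) by (field; lra).
      replace (2 * INR n / (2 * INR n + 1) * (INR n * (2 * INR n + 1))) with
        (2 * INR n * INR n) by (field; lra). nra.
    - apply Rmult_le_reg_r with (2 * INR n + 1); [lra|].
      replace (PI * (2 * INR n / (2 * INR n + 1)) * (2 * INR n + 1)) with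
        (4 * INR n * (PI / 2)) by (field; lra). nra. }
  (* Since [0 <= w <= 1], the lower bound on [w^2] passes to [w]. *)
  split; nra.
Qed.

(** * Asymptotics *)

Definition two_r_ln (r m : nat) : R := 2 * INR r * ln (INR m).

Lemma rm_bound_exp r m : (1 <= m)%nat ->
  rm_bound r m = exp (- two_r_ln r m / 2) / sqrt (2 * PI * two_r_ln r m).
Proof.
  intros hm. assert (hm' : 0 < INR m) by (apply lt_0_INR; lia).
  unfold rm_bound, two_r_ln. unfold Rdiv. f_equal.
  - rewrite <- Rpower_pow by exact hm'. unfold Rpower. rewrite <- exp_Ropp.
    f_equal. field.
  - f_equal. f_equal. ring.
Qed.

Lemma eps_r_pos r m : 0 < eps_r r m.
Proof. apply exp_pos. Qed.

Lemma eps_r_pow r m : (r <= m)%nat -> 0 < two_r_ln r m ->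
  (eps_r r m ^ 2 ^ r) ^ 2 = two_r_ln r m / 2 ^ (m - r).
Proof.
  intros hm hL. pose proof (eps_r_pos r m) as he.
  rewrite <- pow_mult. replace (2 ^ r * 2)%nat with (2 ^ (r + 1))%nat
    by (rewrite Nat.pow_add_r; reflexivity).
  rewrite <- Rpower_pow by exact he. unfold eps_r. rewrite Rpower_mult.
  rewrite pow_INR. change (INR 2) with 2.
  rewrite Rinv_l by (apply pow_nonzero; lra).
  fold (two_r_ln r m).
  assert (hp : 0 < Rpower 2 (INR r - INR m)) by apply exp_pos.
  rewrite Rpower_1 by nra.
  replace (INR r - INR m) with (- INR (m - r)) by (rewrite minus_INR by lia; ring).
  rewrite Rpower_Ropp, Rpower_pow by lra. field. apply pow_nonzero. lra.
Qed.

Lemma exp_mult_INR n x : exp (INR n * x) = exp x ^ n.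
Proof.
  rewrite <- Rpower_pow by apply exp_pos. unfold Rpower. now rewrite ln_exp.
Qed.

(** The last two fields make precise that [m] is large. *)
Record regime (r m : nat) (L d W : R) : Prop := {
  regime_r : (1 <= r < m)%nat;
  regime_L : L = two_r_ln r m;
  regime_d : d = eps_r r m ^ 2 ^ r;
  regime_W : W = / d;
  regime_big : 800 <= L;
  regime_exp : exp (4 * L) <= 2 ^ (m - r) }.


Lemma regime_d_pos r m L d W : regime r m L d W -> 0 < d.
Proof. intros H. rewrite (regime_d _ _ _ _ _ H). apply pow_lt, eps_r_pos. Qed.

Lemma regime_d_sqr r m L d W : regime r m L d W -> 2 ^ (m - r) * d ^ 2 = L.
Proof.
  intros [hr hL hd hW hbig hexp].
  rewrite hd, eps_r_pow, <- hL; [|lia|rewrite <- hL; lra].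
  field. apply pow_nonzero. lra.
Qed.

Lemma regime_K r m L d W : regime r m L d W -> 2 ^ (m - r) = L * W ^ 2.
Proof.
  intros H. rewrite <- (regime_d_sqr _ _ _ _ _ H), (regime_W _ _ _ _ _ H).
  field. apply Rgt_not_eq, (regime_d_pos _ _ _ _ _ H).
Qed.

Lemma regime_K_ge r m L d W : regime r m L d W -> L ^ 4 <= 2 ^ (m - r).
Proof.
  intros [hr hL hd hW hbig hexp].
  apply Rle_trans with (2 := hexp).
  replace (exp (4 * L)) with (exp L ^ 4).
  - apply pow_incr. pose proof (exp_ineq1_le L). lra.
  - rewrite <- exp_mult_INR. f_equal. f_equal. simpl. ring.
Qed.

(** Otherwise [2^(m-r) d^2 = L] would contradict [2^(m-r) >= L^4 > L]. *)
Lemma regime_d_lt_1 r m L d W : regime r m L d W -> d < 1.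
Proof.
  intros H. pose proof (regime_d_pos _ _ _ _ _ H) as h0.
  pose proof (regime_d_sqr _ _ _ _ _ H) as h. pose proof (regime_K_ge _ _ _ _ _ H) as h4.
  pose proof (regime_big _ _ _ _ _ H) as hbig.
  destruct (Rlt_le_dec d 1) as [h1|h1]; [exact h1|].
  assert (h2 : 1 <= d ^ 2) by nra.
  assert (h3 : L < L ^ 4).
  { assert (1 < L ^ 3) by (apply Rlt_pow_R1; [lra|lia]).
    replace (L ^ 4) with (L * L ^ 3) by ring. nra. }
  nra.
Qed.

(** The threshold 800 comes from here: [2 PI L <= 8 L <= (L/10)^2]. *)
Lemma sqrt_le_exp L : 800 <= L -> sqrt (2 * PI * L) <= exp (L / 10).
Proof.
  intros hbig. pose proof PI_4. pose proof PI_RGT_0.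
  pose proof (exp_ineq1_le (L / 10)) as h.
  rewrite <- (sqrt_pow2 (exp (L / 10))) by (apply Rlt_le, exp_pos).
  apply sqrt_le_1_alt. apply Rle_trans with ((L / 10) ^ 2); [nra|].
  apply pow_incr. lra.
Qed.

(** The rate 3/5 is 1/2 + 1/10, the second part absorbing the square root in the bound. *)
Lemma regime_bound r m L d W : regime r m L d W ->
  exp (- (3 / 5 * L)) <= rm_bound r m.
Proof.
  intros [hr hL hd hW hbig hexp].
  rewrite rm_bound_exp, <- hL by lia.
  pose proof PI_RGT_0.
  assert (hs : 0 < sqrt (2 * PI * L)) by (apply sqrt_lt_R0; nra).
  apply Rmult_le_reg_r with (sqrt (2 * PI * L)); [exact hs|].
  replace (exp (- L / 2) / sqrt (2 * PI * L) * sqrt (2 * PI * L)) with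
    (exp (- (3 / 5 * L)) * exp (L / 10)).
  - apply Rmult_le_compat_l; [apply Rlt_le, exp_pos|now apply sqrt_le_exp].
  - rewrite <- exp_plus. replace (- (3 / 5 * L) + L / 10) with (- L / 2) by field.
    field. lra.
Qed.

(** A smaller [W] would give [L W^2 < exp (17L/5)], against [L W^2 = 2^(m-r) >= exp (4L)]. The rate
    6/5 is twice the 3/5 of [regime_bound], so that [1 / sqrt W] falls below the bound. *)
Lemma regime_W_ge r m L d W : regime r m L d W -> exp (6 / 5 * L) <= W.
Proof.
  intros H. pose proof (regime_d_pos _ _ _ _ _ H) as h0.
  pose proof (regime_K _ _ _ _ _ H) as hK.
  destruct H as [hr hL hd hW hbig hexp].
  assert (hW0 : 0 < W) by (rewrite hW; now apply Rinv_0_lt_compat).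
  pose proof (exp_ineq1_le L) as he.
  destruct (Rle_lt_dec (exp (6 / 5 * L)) W) as [h|h]; [exact h|exfalso].
  assert (hx := exp_pos (6 / 5 * L)).
  assert (h2 : W ^ 2 < exp (6 / 5 * L) * exp (6 / 5 * L)) by nra.
  rewrite <- exp_plus in h2. replace (6 / 5 * L + 6 / 5 * L) with (12 / 5 * L) in h2 by field.
  assert (h3 : L * W ^ 2 < exp L * exp (12 / 5 * L)).
  { apply Rle_lt_trans with (exp L * W ^ 2); [apply Rmult_le_compat_r; nra|].
    apply Rmult_lt_compat_l; [apply exp_pos|exact h2]. }
  rewrite <- exp_plus, <- hK in h3.
  assert (exp (L + 12 / 5 * L) < exp (4 * L)) by (apply exp_increasing; lra). lra.
Qed.

Lemma regime_W_gt_1 r m L d W : regime r m L d W -> 1 < W.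
Proof.
  intros H. pose proof (regime_W_ge _ _ _ _ _ H). pose proof (regime_big _ _ _ _ _ H).
  pose proof (exp_ineq1_le (6 / 5 * L)). lra.
Qed.

Lemma regime_chebyshev r m L d W : regime r m L d W ->
  12 / (L * sqrt W) <= rm_bound r m.
Proof.
  intros H. apply Rle_trans with (2 := regime_bound _ _ _ _ _ H).
  assert (h : exp (3 / 5 * L) <= sqrt W).
  { rewrite <- (sqrt_pow2 (exp (3 / 5 * L))) by (apply Rlt_le, exp_pos).
    apply sqrt_le_1_alt. apply Rle_trans with (2 := regime_W_ge _ _ _ _ _ H). right.
    rewrite <- exp_mult_INR. f_equal. simpl. field. }
  pose proof (exp_pos (3 / 5 * L)) as h0. pose proof (regime_big _ _ _ _ _ H) as hbig.
  rewrite exp_Ropp. replace (12 / (L * sqrt W)) with (12 / L * / sqrt W) by (field; lra).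
  rewrite <- (Rmult_1_l (/ exp _)).
  apply Rmult_le_compat.
  - apply Rlt_le, Rdiv_lt_0_compat; lra.
  - apply Rlt_le, Rinv_0_lt_compat; lra.
  - apply Rmult_le_reg_r with L; [lra|]. replace (12 / L * L) with 12 by (field; lra). lra.
  - apply Rinv_le_contravar; lra.
Qed.

(** * Left-end paths with a step 1 before their last step 0 *)

Lemma sum_err_shifted r m L d W l c : regime r m L d W -> (1 <= c <= m - r)%nat ->
  good l d ((1 + W / 2 ^ c) ^ 2 - 1) ->
  sum_err l (2 ^ (m - r - c)) <= rm_bound r m.
Proof.
  intros H hc hl. pose proof (regime_d_pos _ _ _ _ _ H) as hd0.
  pose proof (regime_W_gt_1 _ _ _ _ _ H) as hW1.
  pose proof (regime_K _ _ _ _ _ H) as hK.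
  pose proof (regime_W _ _ _ _ _ H) as hW. pose proof (regime_big _ _ _ _ _ H) as hbig.
  assert (ht : 2 <= 2 ^ c).
  { replace 2 with (2 ^ 1) at 1 by ring. apply Rle_pow; [lra|lia]. }
  assert (hn : INR (2 ^ (m - r - c)) = L * W ^ 2 / 2 ^ c).
  { rewrite pow_INR. change (INR 2) with 2. rewrite <- hK.
    apply Rmult_eq_reg_r with (2 ^ c); [|lra].
    rewrite <- pow_add. replace (m - r - c + c)%nat with (m - r)%nat by lia.
    field. lra. }
  set (t := 2 ^ c) in *.
  assert (htW : 0 < t / W) by (apply Rdiv_lt_0_compat; lra).
  (* If [100 t^2 <= W] then [100 W t^2 <= (t + W)^2], which is the hypothesis of the Chernoff
     bound. *)
  destruct (Rle_lt_dec (100 * t ^ 2) W) as [h|h].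
  - apply Rle_trans with (2 := regime_bound _ _ _ _ _ H).
    apply Rle_trans with
      (exp (- (5 / 16 * INR (2 ^ (m - r - c)) / (1 + ((1 + W / t) ^ 2 - 1))))).
    + apply sum_err_chernoff with (1 := hl).
      replace (1 / d) with W by (rewrite hW; field; lra).
      apply Rmult_le_reg_r with (t ^ 2); [nra|].
      replace ((1 + ((1 + W / t) ^ 2 - 1)) / 100 * t ^ 2) with ((t + W) ^ 2 / 100)
        by (field; lra).
      nra.
    + rewrite hn.
      replace (5 / 16 * (L * W ^ 2 / t) / (1 + ((1 + W / t) ^ 2 - 1))) with
        (5 / 16 * L * (t / (1 + t / W) ^ 2)).
      2:{ field. repeat split; try lra. nra. }
      (* As [t >= 2] and [t/W <= 1/100], the quotient is at least 2/1.0201; then 5/16 times 1.96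
         exceeds 3/5. *)
      assert (hq : 196 / 100 <= t / (1 + t / W) ^ 2).
      { assert (h1 : t / W <= 1 / 100).
        { apply Rmult_le_reg_r with W; [lra|].
          replace (t / W * W) with t by (field; lra). nra. }
        apply Rmult_le_reg_r with ((1 + t / W) ^ 2); [nra|].
        replace (t / (1 + t / W) ^ 2 * (1 + t / W) ^ 2) with t
          by (field; repeat split; lra).
        assert ((1 + t / W) ^ 2 <= 102010 / 100000) by nra. lra. }
      apply Rnot_lt_le. intros hlt. apply exp_lt_inv in hlt. nra.
  - apply Rle_trans with (2 := regime_chebyshev _ _ _ _ _ H).
    apply Rle_trans with (1 := sum_err_chebyshev _ _ _ _ hl (nat_pow2_pos _)).
    rewrite hn.
    set (w := sqrt W).
    assert (hw : w * w = W) by (apply sqrt_sqrt; lra).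
    assert (hw0 : 1 < w).
    { unfold w. rewrite <- sqrt_1. apply sqrt_lt_1_alt. lra. }
    (* From [W < 100 t^2]; it leads to [2 + w^2/t <= 2 + 10 w <= 12 w], the source of the 12 in
       [regime_chebyshev]. *)
    assert (htw : w < 10 * t) by nra.
    rewrite <- hw.
    replace (((1 + w * w / t) ^ 2 - 1) / (L * (w * w) ^ 2 / t)) with
      ((2 + w * w / t) / (L * (w * w))) by (field; repeat split; lra).
    apply Rmult_le_reg_r with (L * (w * w)); [nra|].
    replace ((2 + w * w / t) / (L * (w * w)) * (L * (w * w))) with (2 + w * (w / t))
      by (field; repeat split; lra).
    replace (12 / (L * w) * (L * (w * w))) with (12 * w)
      by (field; repeat split; lra).
    assert (w / t <= 10).
    { apply Rmult_le_reg_r with t; [lra|]. replace (w / t * t) with w by (field; lra). lra. }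
    nra.
Qed.

(** * Two-sided estimate on the path [xi_star] *)

Lemma rm_bound_pos r m L d W : regime r m L d W -> 0 < rm_bound r m.
Proof.
  intros H. pose proof (regime_bound _ _ _ _ _ H). pose proof (exp_pos (- (3 / 5 * L))). lra.
Qed.

(** From [1 + x <= exp x] and [1 - x <= exp (-x)]. *)
Lemma one_minus_mult_exp_bounds x : 0 <= x <= 1 -> 1 - x ^ 2 <= (1 - x) * exp x <= 1.
Proof.
  intros hx. pose proof (exp_ineq1_le x) as h1. pose proof (exp_ineq1_le (- x)) as h2.
  split; [nra|]. replace 1 with (exp (- x) * exp x) at 2.
  - apply Rmult_le_compat_r; [apply Rlt_le, exp_pos|lra].
  - rewrite <- exp_plus, Rplus_opp_l. apply exp_0.
Qed.

Lemma bernoulli x n : 0 <= x <= 1 -> 1 - INR n * x <= (1 - x) ^ n.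
Proof.
  intros hx. induction n as [|n IH]; [simpl; lra|].
  rewrite S_INR, <- tech_pow_Rmult. pose proof (pos_INR n) as hn.
  apply Rmult_le_compat_l with (r := 1 - x) in IH; [|lra]. nra.
Qed.

Lemma perr_xi_star r m L d W : regime r m L d W ->
  1 - 11 / L <= perr (eps_r r m) m r (xi_star m r) / rm_bound r m <= 1.
Proof.
  intros H. pose proof (regime_d_pos _ _ _ _ _ H) as hd0.
  pose proof (regime_d_lt_1 _ _ _ _ _ H) as hd1.
  pose proof (regime_d_sqr _ _ _ _ _ H) as hd2.
  pose proof (regime_K_ge _ _ _ _ _ H) as hK4.
  pose proof (rm_bound_pos _ _ _ _ _ H) as hb0.
  destruct H as [hr hL hd hW hbig hexp]. clear W hW hexp.
  pose proof PI_RGT_0 as hpi.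
  assert (hperr : perr (eps_r r m) m r (xi_star m r) = sum_err (signs d) (2 ^ (m - r))).
  { rewrite perr_path_err. unfold xi_star.
    pose proof (path_err_signs (eps_r r m) r (m - r) (repeat true (m - r)) ltac:(lia)) as h.
    replace (r + (m - r))%nat with m in h by lia. now rewrite h, hd. }
  set (M := (2 ^ (m - r - 1))%nat).
  assert (hM1 : (1 <= M)%nat) by apply nat_pow2_pos.
  assert (hM2 : (2 ^ (m - r) = 2 * M)%nat).
  { unfold M. replace (m - r)%nat with (S (m - r - 1)) at 1 by lia. reflexivity. }
  assert (hK : 2 ^ (m - r) = 2 * INR M).
  { change 2 with (INR 2). rewrite <- pow_INR, hM2, mult_INR. reflexivity. }
  rewrite hK in *. rewrite hperr, hM2.
  assert (hM : 1 <= INR M) by (change 1 with (INR 1); now apply le_INR).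
  pose proof (sum_err_signs_bounds M d hM1 (conj hd0 hd1)) as hS. cbv zeta in hS.
  set (main := choose (2 * M) M / 4 ^ M * (1 - d ^ 2) ^ M / (2 * d)) in *.
  set (p := sum_err (signs d) (2 * M)) in *.
  pose proof (central_choose_bounds M hM1) as hw.
  set (w := choose (2 * M) M / 4 ^ M * sqrt (PI * INR M)) in *.
  (* Since [M d^2 = L/2], this compares [(1 - d^2)^M] with [exp (-d^2)^M]. *)
  set (A := (1 - d ^ 2) ^ M * exp (L / 2)).
  assert (hx : 0 <= d ^ 2 <= 1) by nra.
  assert (hA : A = ((1 - d ^ 2) * exp (d ^ 2)) ^ M).
  { unfold A. rewrite Rpow_mult_distr, <- exp_mult_INR. f_equal. f_equal. lra. }
  pose proof (one_minus_mult_exp_bounds (d ^ 2) hx) as hB.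
  assert (hB0 : 0 <= (1 - d ^ 2) * exp (d ^ 2))
    by (apply Rmult_le_pos; [lra|apply Rlt_le, exp_pos]).
  assert (hA1 : A <= 1).
  { rewrite hA. apply Rle_trans with (1 ^ M); [|rewrite pow1; lra].
    apply pow_incr. split; [exact hB0|apply hB]. }
  assert (hA0 : 0 <= A) by (rewrite hA; now apply pow_le).
  assert (hA2 : 1 - INR M * (d ^ 2) ^ 2 <= A).
  { rewrite hA. apply Rle_trans with ((1 - (d ^ 2) ^ 2) ^ M).
    - apply bernoulli. nra.
    - apply pow_incr. split; [nra|apply hB]. }
  assert (hratio : main = w * A * rm_bound r m).
  { rewrite rm_bound_exp, <- hL by lia.
    replace (2 * PI * L) with ((PI * INR M) * (2 * d) ^ 2) by (rewrite <- hd2; ring).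
    rewrite sqrt_mult_alt by nra. rewrite sqrt_pow2 by lra.
    assert (hs : 0 < sqrt (PI * INR M)) by (apply sqrt_lt_R0; nra).
    unfold main, w, A. replace (- L / 2) with (- (L / 2)) by field.
    rewrite exp_Ropp. pose proof (exp_pos (L / 2)). field.
    repeat split; try lra. apply pow_nonzero; lra. }
  assert (hw0 : 0 < choose (2 * M) M / 4 ^ M).
  { apply Rdiv_lt_0_compat; [apply choose_pos; lia|apply pow_lt; lra]. }
  assert (hw1 : 0 <= w) by (apply Rmult_le_pos; [lra|apply sqrt_pos]).
  assert (hwA : 0 <= w * A <= 1) by nra.
  set (b := rm_bound r m) in *.
  split.
  - apply Rmult_le_reg_r with b; [exact hb0|].
    replace (p / b * b) with p by (field; lra).
    apply Rle_trans with (2 := proj1 hS). rewrite hratio, <- Rmult_assoc.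
    apply Rmult_le_compat_r; [lra|].
    assert (e1 : 4 / (INR M * d ^ 2) = 8 / L).
    { rewrite <- hd2. field. lra. }
    assert (hL1 : L * L ^ 3 <= 2 * INR M) by (replace (L * L ^ 3) with (L ^ 4) by ring; lra).
    assert (e2 : / INR M <= 1 / L).
    { unfold Rdiv. rewrite Rmult_1_l. apply Rinv_le_contravar; [lra|].
      assert (2 <= L ^ 3) by (simpl; nra). nra. }
    assert (e3 : INR M * (d ^ 2) ^ 2 <= 1 / L).
    { replace (INR M * (d ^ 2) ^ 2) with (L ^ 2 / (4 * INR M)).
      - apply Rmult_le_reg_r with (4 * INR M * L); [nra|].
        replace (L ^ 2 / (4 * INR M) * (4 * INR M * L)) with (L ^ 3) by (field; lra).
        replace (1 / L * (4 * INR M * L)) with (4 * INR M) by (field; lra).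
        assert (0 <= L ^ 3) by (apply pow_le; lra). nra.
      - rewrite <- hd2. field. lra. }
    (* The 8/L is the loss in the geometric sum; Wallis' formula and the factor [A] cost 1/L each,
       and the last 1/L is slack. *)
    rewrite e1. replace (11 / L) with (8 / L + 1 / L + 1 / L + 1 / L) by (field; lra).
    assert (0 < 1 / L) by (apply Rdiv_lt_0_compat; lra).
    assert (8 / L <= 1).
    { apply Rmult_le_reg_r with L; [lra|]. replace (8 / L * L) with 8 by (field; lra). lra. }
    assert (0 <= 8 / L) by (replace (8 / L) with (8 * (1 / L)) by (field; lra); lra).
    assert (1 - 1 / L - 1 / L <= w * A) by nra.
    nra.
  - apply Rmult_le_reg_r with b; [exact hb0|].
    replace (p / b * b) with p by (field; lra).
    apply Rle_trans with (1 := proj2 hS). rewrite hratio.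
    apply Rmult_le_compat_r; lra.
Qed.

(** * The bound on all information paths *)

Lemma perr_le_rm_bound r m L d W xi : regime r m L d W -> In xi (Gamma m r) ->
  perr (eps_r r m) m r xi <= rm_bound r m.
Proof.
  intros H hxi.
  pose proof (regime_d_pos _ _ _ _ _ H) as hd0.
  pose proof (regime_d_lt_1 _ _ _ _ _ H) as hd1.
  pose proof (regime_W_gt_1 _ _ _ _ _ H) as hW1.
  pose proof (regime_K _ _ _ _ _ H) as hK.
  pose proof (rm_bound_pos _ _ _ _ _ H) as hb0.
  pose proof (regime_r _ _ _ _ _ H) as hr.
  pose proof (regime_d _ _ _ _ _ H) as hd. pose proof (regime_W _ _ _ _ _ H) as hW.
  pose proof (regime_big _ _ _ _ _ H) as hbig.
  pose proof (eps_r_pos r m) as he0.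
  assert (he1 : eps_r r m <= 1).
  { destruct (Rle_lt_dec (eps_r r m) 1) as [h|h]; [exact h|].
    pose proof (pow_R1_Rle (eps_r r m) (2 ^ r) ltac:(lra)). lra. }
  assert (hg := good_signs (eps_r r m) (conj he0 he1)).
  (* The power [2^(r-1)] of [eps^(-2)] is [eps^(-2^r) = 1/d = W]. *)
  assert (hgain : gain (2 ^ (r - 1)) (/ eps_r r m ^ 2 - 1) = W - 1).
  { unfold gain. replace (1 + (/ eps_r r m ^ 2 - 1)) with (/ eps_r r m ^ 2) by ring.
    rewrite pow_inv, <- pow_mult, hW, hd. do 3 f_equal.
    replace r with (S (r - 1)) at 2 by lia. reflexivity. }
  apply filter_In in hxi. destruct hxi as [hxi hcount]. apply Nat.leb_le in hcount.
  assert (hlen : length xi = m).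
  { clear - hxi. revert xi hxi. induction m as [|k IH]; simpl; intros xi h.
    - destruct h as [<-|[]]. reflexivity.
    - apply in_app_or in h.
      destruct h as [h|h]; apply in_map_iff in h; destruct h as [t [<- ht]];
        simpl; now rewrite (IH t ht). }
  rewrite perr_path_err.
  destruct (path_cases _ _ _ _ _ _ hg hr hlen hcount) as [h|(c & l & hc & h0 & hl & h)];
    rewrite hgain in *.
  (* Right-end paths: Chebyshev gives [(W-1)/(L W^2)], well below [12/(L sqrt W)]. *)
  - apply Rle_trans with (1 := h).
    apply Rle_trans with (2 := regime_chebyshev _ _ _ _ _ H).
    rewrite hK. set (w := sqrt W).
    assert (hw : w * w = W) by (apply sqrt_sqrt; lra).
    assert (hw0 : 1 < w) by (unfold w; rewrite <- sqrt_1; apply sqrt_lt_1_alt; lra).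
    rewrite <- hw. apply Rmult_le_reg_r with (L * (w * w) ^ 2).
    { apply Rmult_lt_0_compat; [lra|]. apply pow_lt. nra. }
    replace ((w * w - 1) / (L * (w * w) ^ 2) * (L * (w * w) ^ 2)) with (w * w - 1)
      by (field; repeat split; lra).
    replace (12 / (L * w) * (L * (w * w) ^ 2)) with (12 * w * (w * w))
      by (field; repeat split; lra).
    nra.
  (* The value [c = 0] forces [xi_star], whose upper bound carries no error term. *)
  - rewrite h. destruct c as [|c].
    + rewrite <- h, (h0 eq_refl), <- perr_path_err.
      pose proof (proj2 (perr_xi_star _ _ _ _ _ H)) as hx.
      apply Rmult_le_compat_r with (r := rm_bound r m) in hx; [|lra].
      unfold Rdiv in hx. rewrite Rmult_assoc, Rinv_l in hx by lra. lra.
    + apply sum_err_shifted with (1 := H); [lia|]. rewrite <- hd in hl.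
      apply good_le with (1 := hl).
      assert (ht : 0 < 2 ^ S c) by (apply pow_lt; lra).
      apply Rplus_le_compat_r, pow_incr. split.
      * assert (0 <= (W - 1) / 2 ^ S c); [|lra].
        apply Rmult_le_pos; [lra|apply Rlt_le, Rinv_0_lt_compat; lra].
      * apply Rplus_le_compat_l, Rmult_le_compat_r;
          [apply Rlt_le, Rinv_0_lt_compat; lra|lra].
Qed.

(** * Large [m] and the limit *)

Lemma two_r_ln_unbounded r B : (1 <= r)%nat ->
  exists N, forall m, (N <= m)%nat -> B < two_r_ln r m.
Proof.
  intros hr. destruct (INR_unbounded (exp (Rabs B))) as [N hN]. exists N.
  intros m hm. pose proof (Rle_abs B) as hB. pose proof (Rabs_pos B) as hB0.
  assert (hmr : exp (Rabs B) < INR m) by (apply le_INR in hm; lra).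
  assert (hln : Rabs B < ln (INR m)).
  { rewrite <- (ln_exp (Rabs B)). apply ln_increasing; [apply exp_pos|exact hmr]. }
  assert (hr' : 1 <= INR r) by (change 1 with (INR 1); now apply le_INR).
  unfold two_r_ln. nra.
Qed.

(** With [s = sqrt m], [ln m <= 2 s], and [4096 r^2 <= m] gives [64 r <= s]. Hence
    [8 r ln m <= 16 r s <= m/4 <= (m-r) ln 2], using [r <= m/2] and [ln 2 > 1/2]. *)
Lemma exp_two_r_ln_le r m : (1 <= r)%nat -> (4096 * r * r <= m)%nat ->
  exp (4 * two_r_ln r m) <= 2 ^ (m - r).
Proof.
  intros hr hm.
  assert (hr' : 1 <= INR r) by (change 1 with (INR 1); now apply le_INR).
  assert (hm' : 4096 * INR r * INR r <= INR m).
  { apply le_INR in hm. rewrite !mult_INR in hm.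
    replace (INR 4096) with 4096 in hm by (rewrite INR_IZR_INZ; reflexivity). exact hm. }
  rewrite <- (exp_ln (2 ^ (m - r))) by (apply pow_lt; lra).
  rewrite ln_pow by lra. rewrite minus_INR by nia.
  assert (hm0 : 0 < INR m) by nra.
  set (s := sqrt (INR m)).
  assert (hs : s * s = INR m) by (apply sqrt_sqrt; lra).
  assert (hs0 : 0 < s) by (now apply sqrt_lt_R0).
  assert (hln : ln (INR m) <= 2 * s).
  { rewrite <- hs, ln_mult by exact hs0.
    assert (ln s <= s); [|lra].
    rewrite <- (ln_exp s) at 2. apply ln_le; [exact hs0|].
    pose proof (exp_ineq1_le s). lra. }
  assert (hs64 : 64 * INR r <= s) by nra.
  pose proof ln_lt_2 as hln2.
  assert (h1 : 4 * two_r_ln r m <= / 4 * INR m) by (unfold two_r_ln; nra).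
  assert (h2 : INR m / 2 <= INR m - INR r) by nra.
  assert (h3 : 4 * two_r_ln r m <= (INR m - INR r) * ln 2) by nra.
  apply Rnot_lt_le. intros h. apply exp_lt_inv in h. lra.
Qed.

Lemma regime_eventually r : (1 <= r)%nat ->
  exists N, forall m, (N <= m)%nat ->
    regime r m (two_r_ln r m) (eps_r r m ^ 2 ^ r) (/ eps_r r m ^ 2 ^ r).
Proof.
  intros hr. destruct (two_r_ln_unbounded r 800 hr) as [N hN].
  exists (N + 4096 * r * r)%nat. intros m hm. split; auto.
  - nia.
  - apply Rlt_le, hN. lia.
  - apply exp_two_r_ln_le; [exact hr|lia].
Qed.

Theorem theorem3 (r : nat) (hr : (1 <= r)%nat) :
  (exists delta : nat -> R, Un_cv delta 0 /\
     exists N : nat, forall m : nat, (N <= m)%nat ->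
       forall xi, In xi (Gamma m r) ->
         perr (eps_r r m) m r xi <= (1 + delta m) * rm_bound r m)
  /\ Un_cv (fun m => perr (eps_r r m) m r (xi_star m r) / rm_bound r m) 1.
Proof.
  destruct (regime_eventually r hr) as [N hN]. split.
  (* For large [m] the bound holds exactly, so the correction may be taken to be 0. *)
  - exists (fun _ => 0). split.
    + intros e he. exists O. intros n _. now rewrite R_dist_eq.
    + exists N. intros m hm xi hxi. rewrite Rplus_0_r, Rmult_1_l.
      exact (perr_le_rm_bound _ _ _ _ _ xi (hN m hm) hxi).
  (* The ratio lies in [[1 - 11/L, 1]], so [L > 11/e] suffices. *)
  - intros e he. destruct (two_r_ln_unbounded r (11 / e) hr) as [N' hN'].
    exists (N + N')%nat. intros m hm.
    pose proof (perr_xi_star _ _ _ _ _ (hN m ltac:(lia))) as h.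
    pose proof (regime_big _ _ _ _ _ (hN m ltac:(lia))) as hbig.
    specialize (hN' m ltac:(lia)).
    set (L := two_r_ln r m) in *.
    assert (11 / L < e).
    { apply Rmult_lt_reg_r with (L / e); [apply Rdiv_lt_0_compat; lra|].
      replace (11 / L * (L / e)) with (11 / e) by (field; lra).
      replace (e * (L / e)) with L by (field; lra). exact hN'. }
    apply Rabs_def1; lra.
Qed.
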